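(* Let $R$ be a CF-ring. Then $\lambda\text{-}\dim(R)\le 2$, and $R$ is coherent if and only if $R_M$ is coherent for every maximal ideal $M$ of $R$.
   Context: All rings are commutative with identity. A canonical form for an $R$-module $E$ is an isomorphism $E\cong R/I_1\oplus\cdots\oplus R/I_n$ with ideals $I_1\subseteq I_2\subseteq\cdots\subseteq I_n\neq R$. $R$ is a CF-ring if every direct sum of finitely many cyclic $R$-modules has a canonical form. For an $R$-module $E$, $\lambda_R(E)$ is the supremum of the $n$ for which there is an exact sequence $F_n\to\cdots\to F_0\to E\to0$ with $F_i$ free of finite rank ($-1$ if $E$ is not finitely generated); $\lambda\text{-}\dim(R)$ is the least $n$ (or $\infty$) such that $\lambda_R(E)\ge n$ implies $\lambda_R(E)=\infty$ for all $R$-modules $E$. *)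

(* Defs.v *)
From HB Require Import structures.
From mathcomp Require Import all_boot all_order all_algebra.

Set Implicit Arguments.
Unset Strict Implicit.
Unset Printing Implicit Defensive.

Import GRing.Theory.
Local Open Scope ring_scope.

Definition is_ideal (R : comPzRingType) (I : R -> Prop) : Prop :=
  I 0 /\ (forall x y, I x -> I y -> I (x + y)) /\ (forall r x, I x -> I (r * x)).

Definition maximal_ideal (R : comPzRingType) (M : R -> Prop) : Prop :=
  is_ideal M /\ ~ M 1 /\
  forall J : R -> Prop, is_ideal J -> (forall x, M x -> J x) ->
    J 1 \/ (forall x, J x -> M x).

(* lambda_R(S) >= n, for a submodule S of the R-module E (given as a subset):
   there is an exact sequence F_n -> ... -> F_1 -> F_0 -> S -> 0 with
   F_i = R^(k i) free of finite rank; the map F_(i+1) -> F_i is x |-> x *m d i,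
   and F_0 -> S is eps (viewed as a map into E with image exactly S). *)
Definition lambda_ge_sub (R : comPzRingType) (E : lmodType R) (S : E -> Prop)
    (n : nat) : Prop :=
  exists (k : nat -> nat) (eps : {linear 'rV[R]_(k 0%N) -> E})
         (d : forall i : nat, 'M[R]_(k i.+1, k i)),
    (forall y : E, S y <-> exists x, eps x = y) /\
    ((0 < n)%N -> forall x : 'rV[R]_(k 0%N), eps x = 0 <-> exists z, z *m d 0%N = x) /\
    (forall i : nat, (i.+1 < n)%N ->
       forall x : 'rV[R]_(k i.+1), x *m d i = 0 <-> exists z, z *m d i.+1 = x).

(* lambda_R(E) >= n  (for n >= 0; lambda_R(E) >= 0 iff E is finitely generated) *)
Definition lambda_ge (R : comPzRingType) (E : lmodType R) (n : nat) : Prop :=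
  lambda_ge_sub (fun _ : E => True) n.

Definition lambda_inf (R : comPzRingType) (E : lmodType R) : Prop :=
  forall m : nat, lambda_ge E m.

Definition lambda_dim_le (R : comPzRingType) (d : nat) : Prop :=
  exists n : nat, (n <= d)%N /\
    forall E : lmodType R, lambda_ge E n -> lambda_inf E.

Definition fg_ideal (R : comPzRingType) (I : R -> Prop) : Prop :=
  exists s : seq R, forall x, I x <->
    exists c : 'I_(size s) -> R, x = \sum_(i < size s) c i * s`_i.

Definition coherent (R : comPzRingType) : Prop :=
  forall I : R -> Prop, is_ideal I -> fg_ideal I -> lambda_ge_sub (E := R^o) I 1.

Definition is_localization (R L : comPzRingType) (phi : {rmorphism R -> L})
    (S : R -> Prop) : Prop :=
  (forall s, S s -> exists u : L, phi s * u = 1) /\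
  (forall y : L, exists r s, S s /\ y * phi s = phi r) /\
  (forall r, phi r = 0 -> exists s, S s /\ s * r = 0).

(* The submodule (+)_j J_j of R^m, so that R^m / dsum J = (+)_j R/J_j. *)
Definition dsum (R : comPzRingType) (m : nat) (J : 'I_m -> R -> Prop)
    (x : 'rV[R]_m) : Prop :=
  forall j : 'I_m, J j (x 0 j).

(* R^m / N  is isomorphic (as an R-module) to  R^n / N'
   (any such isomorphism lifts to a linear map R^m -> R^n, given by a matrix). *)
Definition quot_iso (R : comPzRingType) (m n : nat)
    (N : 'rV[R]_m -> Prop) (N' : 'rV[R]_n -> Prop) : Prop :=
  exists f : 'M[R]_(m, n),
    (forall x, N x -> N' (x *m f)) /\
    (forall y, exists x, N' (y - x *m f)) /\
    (forall x, N' (x *m f) -> N x).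

Definition CF_ring (R : comPzRingType) : Prop :=
  forall (m : nat) (J : 'I_m -> R -> Prop), (forall j, is_ideal (J j)) ->
    exists (n : nat) (I : 'I_n -> R -> Prop),
      (forall i, is_ideal (I i)) /\
      (forall i j : 'I_n, (i <= j)%N -> forall x, I i x -> I j x) /\
      (forall i : 'I_n, ~ I i 1) /\
      quot_iso (dsum J) (dsum I).

(* Main.v *)
(** A decomposition of R/I (+) R/J in canonical form has a first summand
    R/(I /\ J), which gives a + b = 1 with a I <= J and b J <= I; only this
    property of pairs of ideals is used.  It says that the R_M are valuation
    rings, and it has three global consequences.  The minimal primes of any
    ideal are finite in number, since infinitely many would yield an infinite
    independent family of primes, which a Cantor diagonal argument over an almost
    disjoint family excludes.  If a prime Q lies in two maximal ideals M and N,
    each element of Q vanishes in R_M or in R_N.  Hence R_M is a domain for all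
    but finitely many M, and an element outside a prime P lies in only finitely
    many of the maximal ideals containing P.  A submodule of R^n which is locally
    finitely generated is then finitely generated: clearing denominators in a
    basis of its span over the fraction field of R/P, for each minimal prime P,
    takes care of all but finitely many M.  Both claims so reduce to kernels of
    matrices over a valuation ring V, which row operations make diagonal; there
    the point is that if (0 : a) is principal, generated by c, then so is (0 : c). *)
Require Import Defs.
From HB Require Import structures.
From mathcomp Require Import all_boot all_order all_algebra.
From mathcomp Require Import generic_quotient boolp classical_sets cardinality ring.

Set Implicit Arguments.
Unset Strict Implicit.
Unset Printing Implicit Defensive.

Import GRing.Theory.
Local Open Scope ring_scope.

(** * Ideals, and comparability of ideals from canonical forms *)

Definition prime_ideal (R : comPzRingType) (P : R -> Prop) : Prop :=
  is_ideal P /\ ~ P 1 /\ forall x y, P (x * y) -> P x \/ P y.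

(** An elementwise form of [(J : I) + (I : J) = R]. In each [R_M] one of [a], [b] is a unit, so [I]
    and [J] become comparable there. *)
Definition ideals_comparable (R : comPzRingType) : Prop :=
  forall I J : R -> Prop, is_ideal I -> is_ideal J ->
    exists a b : R, [/\ a + b = 1, forall x, I x -> J (a * x)
                      & forall x, J x -> I (b * x)].

Section Ideals.
Variable R : comPzRingType.
Implicit Types (I J K P Q M N : R -> Prop) (x y z s t : R).

Lemma ideal0 I : is_ideal I -> I 0. Proof. by case. Qed.

Lemma idealD I x y : is_ideal I -> I x -> I y -> I (x + y).
Proof. by case=> _ [+ _]; apply. Qed.

Lemma idealMl I x y : is_ideal I -> I y -> I (x * y).
Proof. by case=> _ [_]; apply. Qed.

Lemma idealMr I x y : is_ideal I -> I x -> I (x * y).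
Proof. by rewrite mulrC; apply: idealMl. Qed.

Lemma idealB I x y : is_ideal I -> I x -> I y -> I (x - y).
Proof. by move=> hI hx hy; rewrite -mulN1r; apply: idealD => //; apply: idealMl. Qed.

Lemma ideal_sum I (T : Type) (r : seq T) (A : pred T) (F : T -> R) :
  is_ideal I -> (forall i, A i -> I (F i)) -> I (\sum_(i <- r | A i) F i).
Proof.
move=> hI hF; apply: big_ind => //; first exact: ideal0.
by move=> x y; apply: idealD.
Qed.

Definition multiple y : R -> Prop := fun x => exists r, x = r * y.

Lemma multiple_ideal y : is_ideal (multiple y).
Proof.
split; first by exists 0; rewrite mul0r.
split; first by move=> _ _ [r ->] [r' ->]; exists (r + r'); rewrite mulrDl.
by move=> c _ [r ->]; exists (c * r); rewrite mulrA.
Qed.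

Lemma prime_exp P x n : prime_ideal P -> P (x ^+ n) -> P x.
Proof.
move=> [_ [P1 hP]]; elim: n => [|n IHn]; first by rewrite expr0.
by rewrite exprS => /hP[|/IHn].
Qed.

Lemma maximal_prime M : maximal_ideal M -> prime_ideal M.
Proof.
move=> [hM [M1 maxM]]; split=> //; split=> // x y Mxy.
have [Mx|Mx] := pselect (M x); [by left|right].
pose J z := exists m r, M m /\ z = m + r * x.
have hJ : is_ideal J.
  split; first by exists 0, 0; rewrite mul0r addr0; split => //; apply: ideal0.
  split=> [_ _ [m [r [Mm ->]]] [m' [r' [Mm' ->]]]|c _ [m [r [Mm ->]]]].
    exists (m + m'), (r + r'); split; first exact: idealD.
    by ring.
  exists (c * m), (c * r); split; first exact: idealMl.
  by ring.
have [//|[m' [r [Mm e1]]]|] := maxM J hJ.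
- by move=> z Mz; exists z, 0; rewrite mul0r addr0.
- have -> : y = y * m' + r * (x * y).
    by rewrite -[LHS]mulr1 e1; ring.
  by apply: idealD => //; apply: idealMl.
- move=> sJM; case: Mx; apply: sJM; exists 0, 1; rewrite mul1r add0r.
  by split => //; apply: ideal0.
Qed.

Lemma maximal_eq M N : maximal_ideal M -> maximal_ideal N ->
  (forall x, M x -> N x) -> M = N.
Proof.
move=> [_ [_ maxM]] [hN [N1 _]] sMN; apply/funext => x; apply/propext; split.
  exact: sMN.
by have [//|] := maxM N hN sMN; apply.
Qed.

Lemma maximal_neq M N : maximal_ideal M -> maximal_ideal N -> M <> N ->
  exists x, M x /\ ~ N x.
Proof.
move=> hM hN neqMN; apply: contrapT => h; apply: neqMN.
apply: maximal_eq => // x Mx; apply: contrapT => Nx; apply: h.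
by exists x.
Qed.

Lemma maximal_ideal_above I : is_ideal I -> ~ I 1 ->
  exists M, maximal_ideal M /\ forall x, I x -> M x.
Proof.
move=> hI I1.
pose T := {J : set R | is_ideal J /\ ~ J 1 /\ (I `<=` J)%classic}.
pose leT (J K : T) := `[< (sval J `<=` sval K)%classic >].
have t0 : T by exists I; do 2!split=> //; move=> x.
have [||A totA|J maxJ] := @ZL_preorder T t0 leT.
- by move=> J; apply/asboolP => x.
- move=> J K L /asboolP sJK /asboolP sKL; apply/asboolP => x /sJK.
  exact: sKL.
(* A nonempty chain is bounded by its union; the empty one is bounded by [I] itself. *)
- have [[J0 AJ0]|A0] := pselect (exists J : T, A J); last first.
    by exists t0 => J AJ; case: A0; exists J.
  pose U x := exists2 J : T, A J & sval J x.
  have hU : is_ideal U /\ ~ U 1 /\ (I `<=` U)%classic.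
    split; [split|split].
    + by exists J0 => //; case: (svalP J0) => /ideal0.
    + split=> [x y [J AJ Jx] [K AK Ky]|r x [J AJ Jx]]; last first.
        by exists J => //; case: (svalP J) => hJ _; apply: idealMl.
      have [/asboolP sJK|/asboolP sKJ] := totA _ _ AJ AK.
        exists K => //; case: (svalP K) => hK _.
        by apply: idealD => //; apply: sJK.
      exists J => //; case: (svalP J) => hJ _.
      by apply: idealD => //; apply: sKJ.
    + by case=> J _; case: (svalP J) => _ [].
    + by move=> x Ix; exists J0 => //; case: (svalP J0) => _ [_]; apply.
  exists (exist _ (U : set R) hU) => J AJ; apply/asboolP => x Jx.
  by exists J.
case: J maxJ => J [hJ [J1 sIJ]] maxJ; exists J; split => //.
split=> //; split=> // K hK sJK.
have [K1|K1] := pselect (K 1); [by left|right].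
have hK' : is_ideal K /\ ~ K 1 /\ (I `<=` K)%classic.
  by split=> //; split=> // x /sIJ; apply: sJK.
have := maxJ (exist _ (K : set R) hK').
by move=> /(_ _)/asboolP; apply; apply/asboolP.
Qed.

(** The smallest ideal [A 0] annihilates the whole module, so it lies in [I] and in [J]. The
    projection to [R / A 0] sends the generators of [R / I] and [R / J] to [f 0 0] and [f 1 0], so
    [I * f 0 0] and [J * f 1 0] lie in [A 0]; surjectivity makes 1 a combination of these two
    entries modulo [A 0]. *)
Lemma CF_ideals_comparable : CF_ring R -> ideals_comparable R.
Proof.
move=> hCF I J hI hJ.
pose F (j : 'I_2) := if j == 0 then I else J.
have hF j : is_ideal (F j) by rewrite /F; case: ifP.
have [n [A [hA [monA [_ [f [f_sub [f_onto f_inj]]]]]]]] := hCF 2 F hF.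
case: n => [|n] in A hA monA f f_sub f_onto f_inj *.
  (* With no summands the module is zero, so both ideals are [R]. *)
  have dF (x : 'rV_2) : dsum F x by apply: f_inj; case.
  have I1 : I 1 by have := dF (const_mx 1) 0; rewrite mxE.
  have J1 : J 1 by have := dF (const_mx 1) 1; rewrite mxE.
  exists 1, 0; split=> [|x _|x _]; first by rewrite addr0.
    by rewrite -[_ * _]mulr1; apply: idealMl.
  by rewrite mul0r; apply: ideal0.
have A0IJ c : A 0 c -> I c /\ J c.
  move=> Ac; have dc : dsum F (c *: const_mx 1).
    apply: f_inj => j; rewrite -scalemxAl mxE; apply: idealMr => //.
    by apply: (monA 0).
  by split; [have := dc 0|have := dc 1]; rewrite !mxE mulr1.
have fI x : I x -> A 0 (x * f 0 0).
  move=> Ix; have /f_sub/(_ 0) : dsum F (x *: delta_mx 0 0).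
    move=> j; rewrite !mxE /F /=; case: ifP => _; first exact: idealMr.
    by rewrite mulr0; apply: ideal0.
  by rewrite -scalemxAl -rowE !mxE.
have fJ x : J x -> A 0 (x * f 1 0).
  move=> Jx; have /f_sub/(_ 0) : dsum F (x *: delta_mx 0 1).
    move=> j; rewrite !mxE /F /=; case: ifP => [/eqP ->|_]; last exact: idealMr.
    by rewrite mulr0; apply: ideal0.
  by rewrite -scalemxAl -rowE !mxE.
have [u /(_ 0)] := f_onto (delta_mx 0 0).
rewrite !mxE /= big_ord_recl big_ord1 /= => A1.
have e1 : lift ord0 ord0 = 1 :> 'I_2 by apply: val_inj.
rewrite e1 in A1; set c := (X in A 0 X) in A1; have [Ic Jc] := A0IJ _ A1.
(* The error term [c] lies in both ideals, so it can be absorbed into a coefficient. *)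
exists (u 0 0 * f 0 0 + c), (u 0 1 * f 1 0); split=> [|x Ix|x Jx].
- by rewrite /c; ring.
- rewrite mulrDl; apply: idealD => //; last exact: idealMr.
  by rewrite -mulrA; apply: idealMl => //; have [] := A0IJ _ (fI _ Ix); rewrite mulrC.
- by rewrite -mulrA; apply: idealMl => //; have [] := A0IJ _ (fJ _ Jx); rewrite mulrC.
Qed.

End Ideals.

(** * Primes of a ring with comparable ideals *)

Lemma finite_set_inj (T U : Type) (A : set T) (B : set U) (f : T -> U) :
  (forall x, A x -> B (f x)) ->
  (forall x y, A x -> A y -> f x = f y -> x = y) ->
  finite_set B -> finite_set A.
Proof.
move=> fAB finj finB; rewrite -(eq_finite_set (inj_card_eq (f := f) _)).
  by apply: sub_finite_set finB => _ [x Ax <-]; apply: fAB.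
by move=> x y /set_mem ? /set_mem ?; apply: finj.
Qed.

Section Comparable.
Variable R : comPzRingType.
Hypothesis cmpR : ideals_comparable R.
Implicit Types (I J K P Q M N : R -> Prop) (x y z s t : R).

Definition eventually (A : nat -> Prop) : Prop :=
  exists m, forall k, (m <= k)%N -> A k.

Lemma eventuallyW (A B : nat -> Prop) :
  eventually A -> (forall k, A k -> B k) -> eventually B.
Proof. by move=> [m hA] AB; exists m => k /hA/AB. Qed.

Lemma eventually_and (A B : nat -> Prop) :
  eventually A -> eventually B -> eventually (fun k => A k /\ B k).
Proof.
move=> [m hA] [n hB]; exists (maxn m n) => k.
by rewrite geq_max => /andP[/hA ? /hB ?].
Qed.

Lemma ideal_forall (T : Type) (A : T -> Prop) (P : T -> R -> Prop) :
  (forall i, is_ideal (P i)) -> is_ideal (fun x => forall i, A i -> P i x).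
Proof.
move=> hP; split=> [i _|]; first exact: ideal0.
split=> [x y hx hy i Ai|r x hx i Ai]; first by apply: idealD => //; [apply: hx|apply: hy].
by apply: idealMl => //; apply: hx.
Qed.

Lemma ideal_eventually (P : nat -> R -> Prop) :
  (forall k, is_ideal (P k)) -> is_ideal (fun x => eventually (fun k => P k x)).
Proof.
move=> hP; split=> [|]; first by exists 0 => k _; apply: ideal0.
split=> [x y hx hy|r x hx].
  apply: (eventuallyW (eventually_and hx hy)) => k [? ?].
  exact: idealD.
by apply: (eventuallyW hx) => k ?; apply: idealMl.
Qed.

(** Nodes of the binary tree are finite Boolean sequences, coded as numbers by [pickle]. A branch
    thus gives an infinite set of numbers, and distinct branches share only finitely many. *)
Definition branch (f : nat -> bool) (k : nat) : nat := pickle (mkseq f k).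

Lemma branch_inj f g k l : branch f k = branch g l ->
  k = l /\ forall i, (i < k)%N -> f i = g i.
Proof.
move/(pcan_inj (@pickleK (seq bool))) => e.
have ekl : k = l by rewrite -(size_mkseq f k) e size_mkseq.
split=> // i ik; have := congr1 (fun u => nth false u i) e.
by rewrite !nth_mkseq // -ekl.
Qed.

(* The branches of the binary tree form an almost disjoint family of subsets of
   nat that is itself indexed by the subsets of nat.  Comparability applied to
   [J A] and [J (~ A)] separates every subset of nat from its complement;
   applied to [L X] and [L (~ X)] it would separate every subfamily of branches
   from its complement up to finite errors, against Cantor's theorem. *)
Lemma no_independent_primes (P : nat -> R -> Prop) (x : nat -> R) :
  (forall i, prime_ideal (P i)) -> (forall i, ~ P i (x i)) ->
  (forall i j, i <> j -> P j (x i)) -> False.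
Proof.
move=> primeP xi xj.
have idP i : is_ideal (P i) by case: (primeP i).
(* For [i] in [A], [x i] lies in [J A], so [P i] contains [a * x i] and hence [a = 1 - b];
   symmetrically for [b] off [A]. *)
have sep (A : nat -> Prop) : exists b,
    (forall i, ~ A i -> P i b) /\ (forall i, A i -> P i (1 - b)).
  pose J (A : nat -> Prop) y := forall i, ~ A i -> P i y.
  have hJ B : is_ideal (J B) by apply: ideal_forall.
  have [a [b [eab sIJ sJI]]] := cmpR (hJ A) (hJ (fun i => ~ A i)).
  have a_b : 1 - b = a by rewrite -eab addrK.
  exists b; split=> [i nAi|i Ai]; rewrite ?a_b.
    have /sJI/(_ i nAi) : J (fun i => ~ A i) (x i).
      by move=> j /contrapT Aj; apply: xj => eij; rewrite eij in nAi.
    by have [_ [_ hP]] := primeP i; case/hP => // /xi.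
  have /sIJ/(_ i (fun h => h Ai)) : J A (x i).
    by move=> j nAj; apply: xj => eij; rewrite eij in Ai.
  by have [_ [_ hP]] := primeP i; case/hP => // /xi.
pose L (X : (nat -> bool) -> Prop) y :=
  forall f, ~ X f -> eventually (fun k => P (branch f k) y).
have hL Y : is_ideal (L Y).
  by apply: ideal_forall => f; apply: ideal_eventually => k.
(* A branch is itself a subset of nat; the diagonal family [X] collects the branches that do not
   contain almost all of their own nodes. *)
pose X (f : nat -> bool) := ~ eventually (fun k => f (branch f k)).
have [a [b [eab sIJ sJI]]] := cmpR (hL X) (hL (fun f => ~ X f)).
have sep_branch f : exists c, (forall g, f <> g -> eventually (fun k => P (branch g k) c))
    /\ forall k, ~ P (branch f k) c.
  have [c [cP cP']] := sep (fun i => exists k, i = branch f k).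
  exists c; split=> [g neq_fg|k Pc]; last first.
    have [hP [P1 _]] := primeP (branch f k); apply: P1.
    rewrite -(subrK c 1); apply: idealD => //.
    by apply: cP'; exists k.
  have [i fgi] : exists i, f i <> g i.
    apply: contrapT => h; apply: neq_fg; apply: funext => i.
    by apply: contrapT => fgi; apply: h; exists i.
  exists i.+1 => k ik; apply: cP => -[l /branch_inj[_ /(_ i ik)]] e.
  by apply: fgi.
have inX f : X f -> eventually (fun k => P (branch f k) a).
  move=> Xf; have [c [cg cf]] := sep_branch f.
  have /sIJ/(_ f (fun h => h Xf)) ac : L X c.
    by move=> g nXg; apply: cg => efg; rewrite efg in Xf.
  apply: (eventuallyW ac) => k; have [_ [_ hP]] := primeP (branch f k).
  by case/hP => // /cf.
have notX f : ~ X f -> eventually (fun k => P (branch f k) b).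
  move=> nXf; have [c [cg cf]] := sep_branch f.
  have /sJI/(_ f nXf) bc : L (fun f => ~ X f) c.
    by move=> g /contrapT Xg; apply: cg => efg; rewrite efg in nXf.
  apply: (eventuallyW bc) => k; have [_ [_ hP]] := primeP (branch f k).
  by case/hP => // /cf.
(* This branch is the set of indices whose prime contains [a]; it can be neither in [X] nor outside
   it. *)
pose f i := `[< P i a >].
have [Xf|nXf] := pselect (X f).
  by apply: (Xf); apply: (eventuallyW (inX _ Xf)) => k; rewrite /f; move/asboolP.
have [m hm] := eventually_and (notX _ nXf) (contrapT nXf).
have [Pb /asboolP Pa] := hm m (leqnn m).
by have [hP [P1 _]] := primeP (branch f m); apply: P1; rewrite -eab; apply: idealD.
Qed.

(** Comparing [(x)] and [(y)] gives [a + b = 1] such that a prime of [Y] without [x] contains [a]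
    and one without [y] contains [b]. Every prime omits [a] or [b], so one of them is omitted
    infinitely often. If it is [b], those primes contain [y] and [q] is split off; if it is [a],
    they contain [x] and [p] is split off. *)
Lemma split_infinite_primes (Y : set (set R)) :
  (forall P, Y P -> prime_ideal P) ->
  (forall P Q, Y P -> Y Q -> P <> Q -> exists x y,
    [/\ ~ P x, ~ Q y & forall P', Y P' -> P' (x * y)]) ->
  infinite_set Y ->
  exists (q : set R) (Y' : set (set R)) x b,
    [/\ Y q, (Y' `<=` Y)%classic, infinite_set Y',
        ~ q x /\ q b & forall P, Y' P -> P x /\ ~ P b].
Proof.
move=> primeY sepY infY.
have [p [q [Yp Yq neq_pq]]] : exists p q : set R, [/\ Y p, Y q & p <> q].
  have [p Yp] := infinite_setN0 infY.
  apply: contrapT => h; apply: infY.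
  apply: (sub_finite_set (B := [set p]%classic)); last exact: finite_set1.
  move=> q Yq; apply: contrapT => neq; apply: h; exists p, q.
  by split => // epq; apply: neq.
have [x [y [px qy xyY]]] := sepY p q Yp Yq neq_pq.
have [a [b [eab hax hby]]] := cmpR (multiple_ideal x) (multiple_ideal y).
have axy : multiple y (a * x) by apply: hax; exists 1; rewrite mul1r.
have bxy : multiple x (b * y) by apply: hby; exists 1; rewrite mul1r.
have ca P : Y P -> ~ P x -> P a /\ P y.
  move=> YP Px; have [hP [_ primeP]] := primeY _ YP.
  have Py : P y by case/primeP: (xyY _ YP).
  split=> //; have : P (a * x) by case: axy => r ->; apply: idealMl.
  by case/primeP.
have cb P : Y P -> ~ P y -> P b /\ P x.
  move=> YP Py; have [hP [_ primeP]] := primeY _ YP.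
  have Px : P x by case/primeP: (xyY _ YP).
  split=> //; have : P (b * y) by case: bxy => r ->; apply: idealMl.
  by case/primeP.
have [infb|finb] := pselect (infinite_set (Y `&` [set P | ~ P b])%classic).
  exists q, (Y `&` [set P | ~ P b])%classic, y, b; split=> //.
  - by split=> //; case: (cb _ Yq qy).
  - move=> P [YP Pb]; split=> //; apply: contrapT => Py.
    by case: (cb _ YP Py).
exists p, (Y `&` [set P | ~ P a])%classic, x, a; split=> //.
- move=> fina; apply: infY; apply: (sub_finite_set (B :=
    (Y `&` [set P | ~ P a]) `|` (Y `&` [set P | ~ P b]))%classic); last first.
    by rewrite finite_setU; split=> //; apply: contrapT.
  move=> P YP; have [hP [P1 _]] := primeY _ YP.
  have [Pa|Pa] := pselect (P a); [right|left]; split=> //= Pb.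
  by apply: P1; rewrite -eab; apply: idealD.
- by split=> //; case: (ca _ Yp px).
- move=> P [YP Pa]; split=> //; apply: contrapT => Px.
  by case: (ca _ YP Px).
Qed.

(** Repeated splitting of an infinite set would produce an independent sequence of primes. *)
Lemma finite_separated_primes (Y : set (set R)) :
  (forall P, Y P -> prime_ideal P) ->
  (forall P Q, Y P -> Y Q -> P <> Q -> exists x y,
    [/\ ~ P x, ~ Q y & forall P', Y P' -> P' (x * y)]) ->
  finite_set Y.
Proof.
move=> primeY sepY; apply: contrapT => infY.
pose T := {Z : set (set R) | (Z `<=` Y)%classic /\ infinite_set Z}.
have step (Z : T) : exists w : (set R * T) * (R * R),
    [/\ sval Z w.1.1, (sval w.1.2 `<=` sval Z)%classic,
        ~ w.1.1 w.2.1 /\ w.1.1 w.2.2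
      & forall P, sval w.1.2 P -> P w.2.1 /\ ~ P w.2.2].
  case: Z => Z [sZY infZ]; have [||q [Z' [x [b [Zq sZ' infZ' hq hZ']]]]] :=
    split_infinite_primes _ _ infZ.
  - by move=> P /sZY/primeY.
  - move=> P Q /sZY YP /sZY YQ /(sepY _ _ YP YQ) [x [y [Px Qy xy]]].
    by exists x, y; split=> // P' /sZY/xy.
  have hZ : (Z' `<=` Y)%classic /\ infinite_set Z'.
    by split => // P /sZ'/sZY.
  by exists ((q, exist _ Z' hZ), (x, b)).
have [next hnext] := choice step.
have hY : (Y `<=` Y)%classic /\ infinite_set Y by split.
pose Z n : T := iter n (fun Z => (next Z).1.2) (exist _ Y hY).
pose q n := (next (Z n)).1.1; pose x n := (next (Z n)).2.1.
pose b n := (next (Z n)).2.2.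
have Zq n : sval (Z n) (q n) by case: (hnext (Z n)).
have subZ n m : (n <= m)%N -> (sval (Z m) `<=` sval (Z n))%classic.
  move=> /subnK <-; elim: (m - n)%N => [|k IHk]; first by [].
  by rewrite addSn => P hP; apply: IHk; case: (hnext (Z (k + n)%N)) => _ + _ _; apply.
have prime_q n : prime_ideal (q n).
  by apply: primeY; have := Zq n; case: (svalP (Z n)) => + _; apply.
have qx n : ~ q n (x n) by case: (hnext (Z n)) => _ _ [].
have qb n : q n (b n) by case: (hnext (Z n)) => _ _ [].
have qxb n m : (n < m)%N -> q m (x n) /\ ~ q m (b n).
  by move=> nm; case: (hnext (Z n)) => _ _ _; apply; apply: (subZ _ _ nm).
(* The factor [x n] lies in every later prime, each [b i] lies in the earlier prime [q i], and no
   factor lies in [q n]. *)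
pose c n := x n * \prod_(i < n) b i.
have hprod : forall n m, (n <= m)%N -> ~ q m (\prod_(i < n) b i).
  move=> n m; elim: n => [_|n IHn nm].
    by rewrite big_ord0; case: (prime_q m) => _ [].
  rewrite big_ord_recr /=; case: (prime_q m) => _ [_ hq] /hq[].
    exact: IHn (ltnW nm).
  by case: (qxb _ _ nm).
apply: (no_independent_primes (P := q) (x := c)) => //.
  move=> i; case: (prime_q i) => _ [_ hq] /hq[]; first exact: qx.
  exact: hprod.
move=> i j /eqP; case: (ltngtP i j) => // ij _; case: (prime_q j) => hj _.
  by apply: idealMr => //; case: (qxb _ _ ij).
by apply: idealMl => //; rewrite (bigD1 (Ordinal ij)) //=; apply: idealMr.
Qed.

(* The radical of the localization of [K] at [M], pulled back: as the primes
   inside [M] form a chain, it is the only minimal prime of [K] inside [M]. *)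
Definition min_prime K M : set R := fun x => exists s n, ~ M s /\ K (s * x ^+ n).

Lemma maximal_mul M s t : maximal_ideal M -> ~ M s -> ~ M t -> ~ M (s * t).
Proof. by case/maximal_prime => _ [_ hM] Ms Mt /hM[]. Qed.

(** The valuation property of [R_M], with the denominators cleared. *)
Lemma comparable_at M x y : maximal_ideal M ->
  exists a r, ~ M a /\ (a * x = r * y \/ a * y = r * x).
Proof.
move=> [hM [M1 _]].
have [a [b [eab hx hy]]] := cmpR (multiple_ideal x) (multiple_ideal y).
have [r er] : multiple y (a * x) by apply: hx; exists 1; rewrite mul1r.
have [r' er'] : multiple x (b * y) by apply: hy; exists 1; rewrite mul1r.
have [Ma|Ma] := pselect (M a); last by exists a, r; split=> //; left.
exists b, r'; split; last by right.
by move=> Mb; apply: M1; rewrite -eab; apply: idealD.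
Qed.

(** Up to a unit of [R_M], one of [x], [y] divides the other. So [x + y] is a multiple of one of
    them, and a power of one of them is a multiple of a power of [x * y]. *)
Lemma min_primeP K M : is_ideal K -> maximal_ideal M -> (forall x, K x -> M x) ->
  prime_ideal (min_prime K M).
Proof.
move=> hK maxM sKM; have [hM [M1 _]] := maxM.
have idQ : is_ideal (min_prime K M).
  split; first by exists 1, 1%N; rewrite mul1r expr1; split=> //; apply: ideal0.
  have QM r x : min_prime K M x -> min_prime K M (r * x).
    move=> [s [n [Ms Kx]]]; exists s, n; split=> //.
    by rewrite exprMn mulrCA; apply: idealMl.
  have Qcan a x : ~ M a -> min_prime K M (a * x) -> min_prime K M x.
    move=> Ma [s [n [Ms]]]; rewrite exprMn mulrA => Kx.
    exists (s * a ^+ n), n; split=> //; apply: maximal_mul => //.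
    by move/(prime_exp (maximal_prime maxM)).
  split=> // x y Qx Qy; have [a [r [Ma [e|e]]]] := comparable_at x y maxM.
    apply: (Qcan a) => //; have -> : a * (x + y) = (r + a) * y.
      by rewrite mulrDr e mulrDl.
    exact: QM.
  apply: (Qcan a) => //; have -> : a * (x + y) = (r + a) * x.
    by rewrite mulrDr e mulrDl addrC.
  exact: QM.
split=> //; split=> [[s [n [Ms]]]|x y [s [n [Ms Kxy]]]].
  by rewrite expr1n mulr1 => /sKM.
have [a [r [Ma e]]] := comparable_at x y maxM.
have Mas : ~ M (s * a ^+ n).
  by apply: maximal_mul => // /(prime_exp (maximal_prime maxM)).
(* The exponent doubles because [a * x = r * y] yields [a ^+ n * x ^+ (n + n) = r ^+ n * (x * y) ^+
   n]. *)
case: e => e; [left|right]; exists (s * a ^+ n), (n + n)%N; split=> //.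
  have -> : s * a ^+ n * x ^+ (n + n) = r ^+ n * (s * (x * y) ^+ n).
    transitivity (s * (a * x) ^+ n * x ^+ n); first by rewrite exprMn exprD; ring.
    by rewrite e !exprMn; ring.
  exact: idealMl.
have -> : s * a ^+ n * y ^+ (n + n) = r ^+ n * (s * (x * y) ^+ n).
  transitivity (s * (a * y) ^+ n * y ^+ n); first by rewrite exprMn exprD; ring.
  by rewrite e !exprMn; ring.
exact: idealMl.
Qed.

Lemma min_prime_sub K M x : maximal_ideal M -> (forall x, K x -> M x) ->
  min_prime K M x -> M x.
Proof.
move=> maxM sKM [s [n [Ms /sKM]]]; have primeM := maximal_prime maxM.
by have [_ [_ hM]] := primeM; case/hM => // /(prime_exp primeM).
Qed.

Lemma sub_min_prime K M x : maximal_ideal M -> K x -> min_prime K M x.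
Proof. by case=> _ [M1 _] Kx; exists 1, 1%N; rewrite mul1r expr1. Qed.

Lemma min_prime_minimal K M Q : prime_ideal Q -> (forall x, K x -> Q x) ->
  (forall x, Q x -> M x) -> forall x, min_prime K M x -> Q x.
Proof.
move=> primeQ sKQ sQM x [s [n [Ms /sKQ]]]; have [_ [_ hQ]] := primeQ.
by case/hQ => [/sQM //|/(prime_exp primeQ)].
Qed.

(** Distinct primes [Q], [Q'] of this kind are incomparable by minimality, so comparability puts [b]
    in [Q] and [a] in [Q'] with [a + b = 1]. Since [a] is nilpotent modulo [K] at [N], some
    [s * a ^+ n] lies in [K], which separates the two primes. *)
Lemma finite_min_primes K : is_ideal K ->
  finite_set [set Q | exists M, [/\ maximal_ideal M, forall x, K x -> M x
                                  & Q = min_prime K M]]%classic.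
Proof.
move=> hK; apply: finite_separated_primes.
  by move=> _ [M [maxM sKM ->]]; apply: min_primeP.
move=> _ _ [M [maxM sKM ->]] [N [maxN sKN ->]] neq.
have primeQ := min_primeP hK maxM sKM; have primeQ' := min_primeP hK maxN sKN.
set Q := min_prime K M in neq primeQ *; set Q' := min_prime K N in neq primeQ' *.
have [hQ [Q1 Qmul]] := primeQ; have [hQ' [Q'1 Q'mul]] := primeQ'.
have [a [b [eab sQQ' sQ'Q]]] := cmpR hQ hQ'.
have sKQ x : K x -> Q x by apply: sub_min_prime.
have sKQ' x : K x -> Q' x by apply: sub_min_prime.
have sQM x : Q x -> M x by apply: min_prime_sub.
have sQ'N x : Q' x -> N x by apply: min_prime_sub.
have Qb : Q b.
  apply: contrapT => Qb; apply: neq; apply/funext => x; apply/propext.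
  have sub y : Q' y -> Q y by move=> /sQ'Q/Qmul[].
  split; last exact: sub.
  by apply: min_prime_minimal => // y /sub/sQM.
have Q'a : Q' a.
  apply: contrapT => Q'a; apply: neq; apply/funext => x; apply/propext.
  have sub y : Q y -> Q' y by move=> /sQQ'/Q'mul[].
  split; first exact: sub.
  by apply: min_prime_minimal => // y /sub/sQ'N.
have [s [n [Ns Ksa]]] := Q'a; exists (a ^+ n), s; split.
- move/(prime_exp primeQ) => Qa; apply: Q1; rewrite -eab.
  exact: idealD.
- by move/sQ'N.
- by move=> _ [M' [maxM' _ ->]]; apply: sub_min_prime; rewrite // mulrC.
Qed.

(* [y] vanishes in [R_M]. *)
Definition killed_at M y : Prop := exists s, ~ M s /\ s * y = 0.

(** The difference [m - u] stays outside [M], so it is a unit of [R_M]. *)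
Lemma not_killed_unit M u m y : maximal_ideal M -> ~ M u -> M m ->
  (m - u) * y = 0 -> killed_at M y.
Proof.
move=> [hM _] Mu Mm e; exists (m - u); split=> // Mmu; apply: Mu.
by rewrite -(subKr m u); apply: idealB.
Qed.

(** If [y] survived in both local rings, the preimages [S M] and [S N] of [y R_M] and [y R_N] could
    be compared. Elements outside [Q] divide [y] up to common units, which forces both coefficients
    [a] and [b] into [N]. *)
Lemma common_ideal_killed Q M N y : prime_ideal Q ->
  maximal_ideal M -> maximal_ideal N -> M <> N ->
  (forall x, Q x -> M x) -> (forall x, Q x -> N x) -> Q y ->
  killed_at M y \/ killed_at N y.
Proof.
move=> primeQ maxM maxN neqMN sQM sQN Qy.
have [hQ [Q1 Qmul]] := primeQ.
apply: contrapT => /not_orP [My Ny].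
pose S N z := exists s, ~ N s /\ multiple y (s * z).
have hS N' : maximal_ideal N' -> is_ideal (S N').
  move=> maxN'; have [_ [N'1 _]] := maxN'.
  split; first by exists 1; split=> //; exists 0; rewrite mulr0 mul0r.
  split=> [u v [s [Ns [c es]]] [t [Nt [d et]]]|r u [s [Ns [c es]]]].
    exists (s * t); split; first exact: maximal_mul.
    exists (t * c + s * d).
    transitivity (t * (s * u) + s * (t * v)); first by ring.
    by rewrite es et; ring.
  exists s; split=> //; exists (r * c); rewrite mulrCA es; ring.
have [a [b [eab sNM sMN]]] := cmpR (hS N maxN) (hS M maxM).
(* As [v * t] is a multiple of [y], the prime [Q] contains [v], and [u = 1 - v] is a unit at both
   [M] and [N]. *)
have div t : ~ Q t -> exists u r, [/\ ~ M u, ~ N u & u * y = r * t].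
  move=> Qt; have [u [v [euv hy ht]]] := cmpR (multiple_ideal y) (multiple_ideal t).
  have [r er] : multiple t (u * y) by apply: hy; exists 1; rewrite mul1r.
  have [r' er'] : multiple y (v * t) by apply: ht; exists 1; rewrite mul1r.
  have Qv : Q v by have : Q (v * t) by [rewrite er'; apply: idealMl]; case/Qmul.
  exists u, r; split=> // hu.
    by case: maxM => hM [M1 _]; apply: M1; rewrite -euv; apply: idealD => //; apply: sQM.
  by case: maxN => hN [N1 _]; apply: N1; rewrite -euv; apply: idealD => //; apply: sQN.
(* If [b] were a unit at [N], dividing [y] by some [t] in [N] outside [M] would make [y] a multiple
   of [t * y] in [R_N], hence zero there. *)
have bN : N b.
  apply: contrapT => Nb; apply: Ny.
  have [t [Nt Mt]] := maximal_neq maxN maxM (fun e => neqMN (esym e)).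
  have [u [r [Mu Nu e]]] := div t (fun h => Mt (sQM _ h)).
  have /sMN[s [Ns [c es]]] : S M r by exists t; split=> //; exists u; rewrite e mulrC.
  apply: (@not_killed_unit N (s * b * u) (c * t)) => //.
  - by do 2!apply: maximal_mul => //.
  - by case: maxN => hN _; apply: idealMl.
  have -> : (c * t - s * b * u) * y = t * (c * y) - s * b * (u * y) by ring.
  by rewrite -es e; ring.
have aM : M a.
  apply: contrapT => Ma; apply: My.
  have [t [Mt Nt]] := maximal_neq maxM maxN neqMN.
  have [u [r [Mu Nu e]]] := div t (fun h => Nt (sQN _ h)).
  have /sNM[s [Ms [c es]]] : S N r by exists t; split=> //; exists u; rewrite e mulrC.
  apply: (@not_killed_unit M (s * a * u) (c * t)) => //.
  - by do 2!apply: maximal_mul => //.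
  - by case: maxM => hM _; apply: idealMl.
  have -> : (c * t - s * a * u) * y = t * (c * y) - s * a * (u * y) by ring.
  by rewrite -es e; ring.
(* Here [a] is already in [M]. Were it outside [N], dividing [y] by [a * a] would make [y] a
   multiple of [a * y] in [R_M], hence zero there. *)
have aN : N a.
  apply: contrapT => Na; apply: My.
  have Na2 : ~ N (a * a) by apply: maximal_mul.
  have [u [r [Mu Nu e]]] := div (a * a) (fun h => Na2 (sQN _ h)).
  have /sNM[t [Mt [c et]]] : S N r.
    by exists (a * a); split=> //; exists u; rewrite e mulrC.
  apply: (@not_killed_unit M (t * u) (c * a)) => //.
  - exact: maximal_mul.
  - by case: maxM => hM _; apply: idealMl.
  have -> : (c * a - t * u) * y = a * (c * y) - t * (u * y) by ring.
  by rewrite -et e; ring.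
by case: maxN => hN [N1 _]; apply: N1; rewrite -eab; apply: idealD.
Qed.

(* In the valuation ring [R_M], a nonzero nilpotent is what prevents [R_M] from
   being a domain. *)
Definition nondomain_at M : Prop :=
  maximal_ideal M /\ exists y, min_prime (eq 0) M y /\ ~ killed_at M y.

Lemma zero_ideal : is_ideal (eq (0 : R)).
Proof.
split=> //; split=> [x y <- <-|r x <-]; by rewrite ?addr0 ?mulr0.
Qed.

Lemma killedB M x y : maximal_ideal M -> killed_at M x -> killed_at M y ->
  killed_at M (x - y).
Proof.
move=> maxM [s [Ms es]] [t [Mt et]]; exists (s * t); split.
  exact: maximal_mul.
have -> : s * t * (x - y) = t * (s * x) - s * (t * y) by ring.
by rewrite es et; ring.
Qed.

Lemma zero_in M : maximal_ideal M -> forall x, 0 = x -> M x.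
Proof. by case=> hM _ x <-; apply: ideal0. Qed.

(** If two such ideals shared their minimal prime, [x] surviving only at [M] and [y] surviving only
    at [N] would give [x - y] surviving at both. *)
Lemma finite_nondomain_at : finite_set (nondomain_at : set (set R)).
Proof.
have injQ M N : nondomain_at M -> nondomain_at N -> min_prime (eq 0) M = min_prime (eq 0) N -> M = N.
  move=> [maxM [x [Qx kx]]] [maxN [y [Qy ky]]] eQ; apply: contrapT => neqMN.
  have zM := zero_in maxM; have zN := zero_in maxN.
  have primeQ := min_primeP zero_ideal maxM zM.
  have kill z : min_prime (eq 0) M z -> killed_at M z \/ killed_at N z.
    apply: common_ideal_killed => // u; first exact: min_prime_sub.
    by rewrite eQ; apply: min_prime_sub.
  rewrite -eQ in Qy; have [hQ _] := primeQ.
  have xN : killed_at N x by case: (kill x Qx).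
  have yM : killed_at M y by case: (kill y Qy).
  have [kxy|kxy] := kill (x - y) (idealB hQ Qx Qy).
    apply: kx; rewrite -(subrK y x) -[y in _ + y]opprK.
    apply: killedB => //; rewrite -sub0r; apply: killedB => //.
    by exists 1; rewrite mulr0; split=> //; case: maxM => _ [].
  by apply: ky; rewrite -(subKr x y); apply: killedB.
apply: (finite_set_inj (f := min_prime (eq 0))) injQ (finite_min_primes zero_ideal).
by move=> M [maxM _]; exists M; split=> //; apply: zero_in.
Qed.

(** Minimal primes of [K = P + (r)] tell these maximal ideals apart: a shared one contains [r], so
    [r] would be killed at [M] or [N], which puts [r] in [P]. *)
Lemma finite_maximal_above P r : prime_ideal P -> ~ P r ->
  finite_set [set M | [/\ maximal_ideal M, forall x, P x -> M x & M r]]%classic.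
Proof.
move=> primeP Pr; have [hP [P1 Pmul]] := primeP.
pose K x := exists p c, P p /\ x = p + c * r.
have hK : is_ideal K.
  split; first by exists 0, 0; rewrite mul0r addr0; split => //; apply: ideal0.
  split=> [_ _ [p [c [Pp ->]]] [p' [c' [Pp' ->]]]|d _ [p [c [Pp ->]]]].
    by exists (p + p'), (c + c'); split; [apply: idealD|ring].
  by exists (d * p), (d * c); split; [apply: idealMl|ring].
have sKM M : maximal_ideal M -> (forall x, P x -> M x) -> M r -> forall x, K x -> M x.
  move=> [hM _] sPM Mr _ [p [c [Pp ->]]].
  by apply: idealD => //; [apply: sPM|apply: idealMl].
have Kr : K r by exists 0, 1; rewrite mul1r add0r; split => //; apply: ideal0.
apply: (finite_set_inj (f := min_prime K)) (finite_min_primes hK).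
  by move=> M [maxM sPM Mr]; exists M; split=> //; apply: sKM.
move=> M N [maxM sPM Mr] [maxN sPN Nr] eQ; apply: contrapT => neqMN.
have sKM' := sKM _ maxM sPM Mr; have sKN' := sKM _ maxN sPN Nr.
have kill N' : (forall x, P x -> N' x) -> ~ killed_at N' r.
  move=> sPN' [s [Ns e]]; have : P (s * r) by rewrite e; apply: ideal0.
  by case/Pmul => // /sPN'.
have [||||/kill|/kill] :=
  @common_ideal_killed (min_prime K M) M N r _ maxM maxN neqMN; last 2 first.
- exact.
- exact.
- exact: min_primeP.
- by move=> x; apply: min_prime_sub.
- by move=> x; rewrite eQ; apply: min_prime_sub.
- exact: sub_min_prime.
Qed.

End Comparable.

(** * Finite generation from local finite generation *)

Definition submodule (R : comPzRingType) (n : nat) (K : 'rV[R]_n -> Prop) : Prop :=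
  K 0 /\ (forall x y, K x -> K y -> K (x + y)) /\ (forall r x, K x -> K (r *: x)).

Definition rowspan (R : comPzRingType) (m n : nat) (W : 'M[R]_(m, n)) : 'rV[R]_n -> Prop :=
  fun z => exists w, w *m W = z.

Section LocalGlobal.
Variables (R : comPzRingType) (n : nat).
Implicit Types (K A B : 'rV[R]_n -> Prop) (P Q M N : R -> Prop).

Lemma submoduleB K x y : submodule K -> K x -> K y -> K (x - y).
Proof. by move=> [_ [KD KZ]] Kx Ky; rewrite -scaleN1r; apply: KD => //; apply: KZ. Qed.

Lemma rowspan_submodule m (W : 'M[R]_(m, n)) : submodule (rowspan W).
Proof.
split; first by exists 0; rewrite mul0mx.
split=> [_ _ [u <-] [v <-]|r _ [u <-]]; first by exists (u + v); rewrite mulmxDl.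
by exists (r *: u); rewrite scalemxAl.
Qed.

Lemma rowspan_col_mxl m p (W : 'M[R]_(m, n)) (V : 'M_(p, n)) z :
  rowspan W z -> rowspan (col_mx W V) z.
Proof. by move=> [w <-]; exists (row_mx w 0); rewrite mul_row_col mul0mx addr0. Qed.

Lemma rowspan_col_mxr m p (W : 'M[R]_(m, n)) (V : 'M_(p, n)) z :
  rowspan V z -> rowspan (col_mx W V) z.
Proof. by move=> [w <-]; exists (row_mx 0 w); rewrite mul_row_col mul0mx add0r. Qed.

Lemma rowspan_col_mx_sub K m p (W : 'M[R]_(m, n)) (V : 'M_(p, n)) : submodule K ->
  (forall z, rowspan W z -> K z) -> (forall z, rowspan V z -> K z) ->
  forall z, rowspan (col_mx W V) z -> K z.
Proof.
move=> [_ [KD _]] WK VK _ [w <-]; rewrite -[w]hsubmxK mul_row_col.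
by apply: KD; [apply: WK; exists (lsubmx w)|apply: VK; exists (rsubmx w)].
Qed.

(** Each condition survives enlarging the submodule, so finitely many are met at once by stacking
    matrices. *)
Lemma rowspan_collect (T : eqType) (F : set T) (C : T -> ('rV[R]_n -> Prop) -> Prop) K :
  submodule K -> finite_set F ->
  (forall t A B, (forall z, A z -> B z) -> C t A -> C t B) ->
  (forall t, F t -> exists m (W : 'M_(m, n)),
    (forall z, rowspan W z -> K z) /\ C t (rowspan W)) ->
  exists m (W : 'M_(m, n)),
    (forall z, rowspan W z -> K z) /\ forall t, F t -> C t (rowspan W).
Proof.
move=> hK /finite_seqP[s ->] monoC; elim: s => [|t s IHs] hF.
  by exists 0%N, 0; split=> // z [w <-]; rewrite mulmx0; case: hK.
have [|m [W [WK hW]]] := IHs.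
  by move=> u us; apply: hF => /=; rewrite inE us orbT.
have [|p [V [VK hV]]] := hF t; first by rewrite /= inE eqxx.
exists (m + p)%N, (col_mx W V); split; first exact: rowspan_col_mx_sub.
move=> u /=; rewrite inE => /orP[/eqP ->|us].
  by apply: monoC hV => z; apply: rowspan_col_mxr.
by apply: monoC (hW u us) => z; apply: rowspan_col_mxl.
Qed.

(* Clearing denominators in a basis of the span of [K] over the fraction field
   of [R / P]. *)
Lemma rowspan_mod_prime P K : prime_ideal P -> submodule K ->
  exists r m (W : 'M[R]_(m, n)), [/\ ~ P r, forall z, rowspan W z -> K z
    & forall z, K z -> exists2 y, rowspan W y & forall j, P ((r *: z - y) 0 j)].
Proof.
move=> [hP [P1 Pmul]] hK.
(* Induction on the number [k] of leading columns in which [K] may be nonzero modulo [P]. *)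
suff main k : forall K, submodule K ->
    (forall z, K z -> forall j : 'I_n, (k <= j)%N -> P (z 0 j)) ->
    exists r m (W : 'M[R]_(m, n)), [/\ ~ P r, forall z, rowspan W z -> K z
      & forall z, K z -> exists2 y, rowspan W y & forall j, P ((r *: z - y) 0 j)].
  by apply: (main n) => // z _ j; rewrite leqNgt ltn_ord.
elim: k => [|k IHk] {hK}K hK Kk.
  exists 1, 0%N, 0; split=> // [z [w <-]|z Kz]; first by rewrite mulmx0; case: hK.
  by exists 0 => [|j]; [exists 0; rewrite mulmx0|rewrite scale1r subr0; apply: Kk].
have [hall|] := pselect (forall z, K z -> forall j : 'I_n, (k <= j)%N -> P (z 0 j)).
  exact: IHk.
move/existsNP => [w] /not_implyP[Kw] /existsNP[jk] /not_implyP[kj Pw].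
have ejk (j : 'I_n) : (k <= j)%N -> (k < j)%N \/ j = jk.
  move=> hj; have ek : k = jk.
    apply/eqP; rewrite eqn_leq kj leqNgt /=; apply/negP => lt.
    by apply: Pw; apply: Kk.
  by move: hj; rewrite leq_eqVlt => /orP[/eqP e|]; [right; apply: val_inj; rewrite /= -e|left].
have [K0 [KD KZ]] := hK.
(* The row [w] is a pivot for column [k]: the combination [w 0 jk *: z - z 0 jk *: w] falls into
   [L], at the cost of the denominator [w 0 jk]. *)
pose L z := K z /\ forall j : 'I_n, (k <= j)%N -> P (z 0 j).
have hL : submodule L.
  split; first by split=> // j _; rewrite mxE; apply: ideal0.
  split=> [x y [Kx Px] [Ky Py]|r x [Kx Px]].
    by split=> [|j kj']; [apply: KD|rewrite mxE; apply: idealD; [|apply: Px|apply: Py]].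
  by split=> [|j kj']; [apply: KZ|rewrite mxE; apply: idealMl => //; apply: Px].
have [|r [m [W [Pr WL hW]]]] := IHk L hL; first by move=> z [].
exists (r * w 0 jk), (m + 1)%N, (col_mx W w); split.
- by move/Pmul => [].
- apply: rowspan_col_mx_sub => // [z /WL[]//|z [c <-]].
  by rewrite [c]mx11_scalar mul_scalar_mx; apply: KZ.
move=> z Kz; have [|y Wy hy] := hW (w 0 jk *: z - z 0 jk *: w).
  split; first by apply: submoduleB => //; apply: KZ.
  move=> j /ejk[kj'|->]; rewrite !mxE; last by rewrite mulrC subrr; apply: ideal0.
  by apply: idealB => //; apply: idealMl => //; apply: Kk.
exists (y + (r * z 0 jk) *: w) => [|j].
  have [_ [WD WZ]] := rowspan_submodule (col_mx W w).
  apply: WD; first exact: rowspan_col_mxl.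
  by apply/WZ/rowspan_col_mxr; exists 1%:M; rewrite mul1mx.
have -> : (r * w 0 jk) *: z - (y + (r * z 0 jk) *: w) =
    r *: (w 0 jk *: z - z 0 jk *: w) - y.
  by rewrite scalerBr !scalerA opprD addrCA addrC -addrA.
exact: hy.
Qed.

Hypothesis cmpR : ideals_comparable R.

Lemma maximal_prod M (I : Type) (s : seq I) (F : I -> R) : maximal_ideal M ->
  (forall i, ~ M (F i)) -> ~ M (\prod_(i <- s) F i).
Proof.
move=> maxM hF; have [_ [M1 _]] := maxM.
by apply: (big_ind (fun x => ~ M x)) => // x y; apply: maximal_mul.
Qed.

Lemma killed_row M (v : 'rV[R]_n) : maximal_ideal M ->
  (forall j, killed_at M (v 0 j)) -> exists s, ~ M s /\ s *: v = 0.
Proof.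
move=> maxM /choice[s hs]; exists (\prod_j s j); split.
  by apply: maximal_prod => // j; case: (hs j).
apply/rowP => j; rewrite !mxE (bigD1 j) //= mulrAC.
by case: (hs j) => _ ->; rewrite mul0r.
Qed.

(** [W1] generates [K] modulo each minimal prime [Q] up to the denominator [r Q], and [W2] generates
    it at the finitely many exceptional maximal ideals. *)
Lemma local_global_fg K : submodule K ->
  (forall M, maximal_ideal M -> exists m (W : 'M[R]_(m, n)),
    (forall z, rowspan W z -> K z) /\
    forall z, K z -> exists2 s, ~ M s & rowspan W (s *: z)) ->
  exists m (W : 'M[R]_(m, n)), forall z, K z <-> rowspan W z.
Proof.
move=> hK loc.
pose minp : set (set R) := [set Q | exists M, [/\ maximal_ideal M,
  forall x, 0 = x -> M x & Q = min_prime (eq 0) M]]%classic.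
have finp : finite_set minp := finite_min_primes cmpR (zero_ideal R).
have prime_minp Q : minp Q -> prime_ideal Q.
  by move=> [M [maxM zM ->]]; apply: min_primeP => //; apply: zero_ideal.
pose C r (Q : set R) A := forall z, K z ->
  exists2 y, A y & forall j, Q ((r *: z - y) 0 j).
have /choice[r hr] : forall Q : set R, exists r, minp Q -> ~ Q r /\
    exists m (W : 'M[R]_(m, n)), (forall z, rowspan W z -> K z) /\ C r Q (rowspan W).
  move=> Q; have [hQ|nQ] := pselect (minp Q); last by exists 0.
  have [r [m [W [Qr WK hW]]]] := rowspan_mod_prime (prime_minp _ hQ) hK.
  by exists r => _; split=> //; exists m, W.
pose above (Q : set R) : set (set R) :=
  [set M | [/\ maximal_ideal M, forall x, Q x -> M x & M (r Q)]]%classic.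
(* Exceptional are the [M] where [R_M] is not a domain or where a denominator [r Q] fails to be a
   unit. *)
pose special : set (set R) :=
  ((nondomain_at (R := R) : set (set R)) `|` \bigcup_(Q in minp) above Q)%classic.
have fins : finite_set special.
  rewrite finite_setU; split; first exact: finite_nondomain_at.
  apply: bigcup_finite => // Q hQ; have [Qr _] := hr Q hQ.
  by apply: finite_maximal_above => //; apply: prime_minp.
have maxs M : special M -> maximal_ideal M by case=> [[]|[Q _ []]].
have [||m1 [W1 [W1K hW1]]] := rowspan_collect (C := fun Q => C (r Q) Q) hK finp.
- by move=> Q A B AB hA z /hA[y Ay hy]; exists y => //; apply: AB.
- by move=> Q /hr[].
pose D (M : set R) A := forall z, K z -> exists2 s, ~ M s & A (s *: z).
have [||m2 [W2 [W2K hW2]]] := rowspan_collect (C := D) hK fins.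
- by move=> M A B AB hA z /hA[s Ms As]; exists s => //; apply: AB.
- by move=> M /maxs/loc.
exists (m1 + m2)%N, (col_mx W1 W2) => z; split; last exact: rowspan_col_mx_sub.
move=> Kz; have hW := rowspan_submodule (col_mx W1 W2).
have [W0 [WD WZ]] := hW.
(* It suffices that the ideal of multipliers sending [z] into the span lies in no maximal ideal. *)
have hI : is_ideal (fun s => rowspan (col_mx W1 W2) (s *: z)).
  split; first by rewrite scale0r.
  split=> [x y hx hy|c x hx]; first by rewrite scalerDl; apply: WD.
  by rewrite -scalerA; apply: WZ.
apply: contrapT => nWz; have [|M [maxM sIM]] := maximal_ideal_above hI.
  by rewrite scale1r.
have [sM|nsM] := pselect (special M).
  have [s Ms W2s] := hW2 M sM z Kz.
  by apply: Ms; apply: sIM; apply: rowspan_col_mxr.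
have hQ : minp (min_prime (eq 0) M) by exists M; split=> //; apply: zero_in.
set Q := min_prime (eq 0) M in hQ.
have [y W1y hy] := hW1 Q hQ z Kz.
have Mr : ~ M (r Q).
  move=> Mr; apply: nsM; right; exists Q => //; split=> // x.
  by apply: min_prime_sub => //; apply: zero_in.
(* Since [R_M] is a domain, the remainder, whose entries lie in [Q], vanishes at [M]. *)
have [|s [Ms es]] := @killed_row M (r Q *: z - y) maxM.
  move=> j; apply: contrapT => nk; apply: nsM; left; split=> //.
  by exists ((r Q *: z - y) 0 j); split=> //; apply: hy.
have : M (s * r Q).
  apply: sIM; rewrite -scalerA -(subrK y (r Q *: z)) scalerDr es add0r.
  by apply: WZ; apply: rowspan_col_mxl.
exact: maximal_mul.
Qed.

End LocalGlobal.

(** * Kernels of matrices over valuation rings *)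

Definition exact_at (R : comPzRingType) (p q r : nat)
    (A : 'M[R]_(q, p)) (B : 'M[R]_(r, q)) : Prop :=
  forall x, x *m A = 0 <-> rowspan B x.

Lemma rowspan_mulmx (R : comPzRingType) m p n (B : 'M[R]_(m, n)) (C : 'M[R]_(p, n)) :
  (forall i, rowspan C (row i B)) -> exists X, X *m C = B.
Proof.
move=> /choice[X hX]; exists (\matrix_i X i).
by apply/row_matrixP => i; rewrite row_mul rowK hX.
Qed.

Lemma rowspan_row (R : comPzRingType) m n (B : 'M[R]_(m, n)) i : rowspan B (row i B).
Proof. by exists (delta_mx 0 i); rewrite rowE. Qed.

(** Finite generation of relations does not depend on the generators. With [X *m C = B] and
    [Y *m B = C], write [z = z *m (1%:M - X *m Y) + z *m X *m Y], where [z *m X] is a relation of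
    [C]. *)
Lemma exact_change (R : comPzRingType) q r r' s (B : 'M[R]_(r, q)) (C : 'M[R]_(r', q))
    (G : 'M[R]_(s, r')) : (forall x, rowspan B x <-> rowspan C x) ->
  exact_at C G -> exists t (H : 'M[R]_(t, r)), exact_at B H.
Proof.
move=> eBC exG.
have [X eX] : exists X, X *m C = B by apply: rowspan_mulmx => i; apply/eBC/rowspan_row.
have [Y eY] : exists Y, Y *m B = C by apply: rowspan_mulmx => i; apply/eBC/rowspan_row.
have GC : G *m C = 0.
  by apply/row_matrixP => i; rewrite row_mul row0; apply/exG/rowspan_row.
exists (r + s)%N, (col_mx (1%:M - X *m Y) (G *m Y)) => z; split=> [zB|[w <-]].
  have /exG[w ew] : z *m X *m C = 0 by rewrite -mulmxA eX.
  exists (row_mx z w); rewrite mul_row_col mulmxBr mulmx1 !mulmxA ew.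
  by rewrite subrK.
rewrite -mulmxA mul_col_mx mulmxBl mul1mx -!mulmxA eY eX subrr GC.
by rewrite col_mx0 mulmx0.
Qed.

Section Valuation.
Variable V : comPzRingType.
Hypothesis totV : forall x y : V, multiple y x \/ multiple x y.

Lemma multiple_refl (x : V) : multiple x x.
Proof. by exists 1; rewrite mul1r. Qed.

Lemma multiple_trans (x y z : V) : multiple x y -> multiple y z -> multiple x z.
Proof. by move=> [a ->] [b ->]; exists (b * a); rewrite mulrA. Qed.

Lemma least_multiple (T : eqType) (f : T -> V) (s : seq T) : s != [::] ->
  exists2 t, t \in s & forall u, u \in s -> multiple (f t) (f u).
Proof.
elim: s => // t s IHs _; have [->|/IHs[u us hu]] := eqVneq s [::].
  exists t; rewrite ?inE ?eqxx // => u; rewrite inE => /eqP ->.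
  exact: multiple_refl.
have [tu|ut] := totV (f t) (f u).
  exists u; first by rewrite inE us orbT.
  by move=> v; rewrite inE => /orP[/eqP ->|/hu].
exists t; first by rewrite inE eqxx.
move=> v; rewrite inE => /orP[/eqP ->|/hu]; first exact: multiple_refl.
exact: multiple_trans.
Qed.

(** The annihilator of [c] contains [a], which generates it unless some [x] in it properly divides
    [a]. In that case [c] turns out to be a unit or zero. *)
Lemma annihilator_annihilator (a c : V) :
  (forall y, y * a = 0 <-> multiple c y) ->
  exists g, forall x, x * c = 0 <-> multiple g x.
Proof.
move=> ann_a.
have ca : c * a = 0 by apply/ann_a/multiple_refl.
have [hall|] := pselect (forall x, x * c = 0 -> multiple a x).
  by exists a => x; split=> [/hall//|[r ->]]; rewrite -mulrA (mulrC a) ca mulr0.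
move=> /existsNP[x] /not_implyP[xc nax].
have [//|[t et]] := totV x a.
have cancel y : multiple c (y * t) -> multiple c y.
  move=> [e he]; apply/ann_a; rewrite et mulrA he -mulrA.
  by rewrite (mulrC c) xc mulr0.
have [[e et']|[d ed]] := totV t c.
  have [u eu] : multiple c 1 by apply: cancel; rewrite mul1r; exists e.
  exists 0 => y; split=> [yc|[r ->]]; last by rewrite mulr0 mul0r.
  by exists 0; rewrite mulr0 -[y]mulr1 eu mulrCA yc mulr0.
have [e ee] : multiple c d by apply: cancel; rewrite -ed; apply: multiple_refl.
have ec : c = e * t * c by rewrite [LHS]ed ee; ring.
(* One of [e * t] and [1 - e * t] divides the other: the first case kills [c], the second makes [x]
   a multiple of [a]. *)
have [[h eh]|[h eh]] := totV (e * t) (1 - e * t).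
  have c0 : c = 0.
    rewrite ec eh; transitivity (h * (c - e * t * c)); first by ring.
    by rewrite -ec subrr mulr0.
  by exists 1 => y; split=> _; [exists y; rewrite mulr1|rewrite c0 mulr0].
case: nax; exists ((h + 1) * e).
transitivity ((1 - e * t) * x + e * (t * x)); first by ring.
by rewrite eh et; ring.
Qed.

(** Only the left kernel becomes diagonal. An entry dividing all others is moved to the first row
    and clears its column; as it also divides its own row, it alone decides when a multiple of that
    row vanishes. *)
Lemma row_diagonalize m n (A : 'M[V]_(m, n)) :
  exists (P P' : 'M[V]_m) (d : 'rV[V]_m), [/\ P *m P' = 1%:M, P' *m P = 1%:M
    & forall x : 'rV_m, x *m (P *m A) = 0 <-> x *m diag_mx d = 0].
Proof.
elim: m n A => [|m IHm] n A.
  exists 1%:M, 1%:M, 0; rewrite !mulmx1; split=> // x.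
  by rewrite [x]thinmx0; split; rewrite !mul0mx.
case: n A => [|n] A.
  exists 1%:M, 1%:M, 0; rewrite !mulmx1 mul1mx; split=> // x; rewrite [A]thinmx0 mulmx0.
  by split; rewrite linear0 mulmx0.
have [|[i0 j0] _ /= hmin] := @least_multiple _ (fun ij : 'I_m.+1 * 'I_n.+1 => A ij.1 ij.2)
    (enum {: 'I_m.+1 * 'I_n.+1}).
  by rewrite -size_eq0 -cardE card_prod !card_ord.
have {}hmin i j : multiple (A i0 j0) (A i j).
  by apply: (hmin (i, j)); rewrite mem_enum.
pose T : 'M[V]_(1 + m) := tperm_mx i0 0.
have TT : T *m T = 1%:M by rewrite -perm_mxM perm.tperm2 perm_mx1.
pose u := usubmx (T *m A : 'M_(1 + m, n.+1)); pose B := dsubmx (T *m A : 'M_(1 + m, n.+1)).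
have uE j : u 0 j = A i0 j.
  have e0 : lshift m (0 : 'I_1) = 0 :> 'I_m.+1 by apply: val_inj.
  by rewrite mxE -xrowE mxE e0 perm.tpermR.
have [c hc] : exists c : 'cV_m, forall i, B i j0 = c i 0 * u 0 j0.
  have /choice[f hf] : forall i, exists r, B i j0 = r * u 0 j0.
    by move=> i; rewrite uE mxE -xrowE mxE; apply: hmin.
  by exists (\col_i f i) => i; rewrite mxE.
have eTA : T *m A = col_mx u B by rewrite vsubmxK.
clearbody u B.
have [P3 [P3' [d [PP' P'P hP]]]] := IHm _ (B - c *m u).
pose E := block_mx 1%:M 0 (- c) 1%:M : 'M[V]_(1 + m).
pose E' := block_mx 1%:M 0 c 1%:M : 'M[V]_(1 + m).
have EE' : E *m E' = 1%:M.
  rewrite mulmx_block !mul1mx !mulmx0 !mul0mx !mulmx1 !addr0 add0r addNr.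
  by rewrite -scalar_mx_block.
have E'E : E' *m E = 1%:M.
  rewrite mulmx_block !mul1mx !mulmx0 !mul0mx !mulmx1 !addr0 add0r addrN.
  by rewrite -scalar_mx_block.
pose D (X : 'M[V]_m) := block_mx 1%:M 0 0 X : 'M[V]_(1 + m).
have DM X Y : D X *m D Y = D (X *m Y).
  by rewrite mulmx_block !mul1mx !mulmx0 !mul0mx !addr0 add0r.
have D1 : D 1%:M = 1%:M by rewrite /D -scalar_mx_block.
exists (D P3 *m E *m T), (T *m E' *m D P3'), (row_mx (u 0 j0)%:M d); split.
- by rewrite -!mulmxA (mulmxA T T) TT mul1mx (mulmxA E E') EE' mul1mx DM PP' D1.
- rewrite -!mulmxA (mulmxA (D P3')) DM P'P D1 mul1mx.
  by rewrite (mulmxA E') E'E mul1mx.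
move=> x; pose y := lsubmx (x : 'rV_(1 + m)); pose z := rsubmx (x : 'rV_(1 + m)).
have -> : x = row_mx y z by rewrite hsubmxK.
clearbody y z.
have -> : D P3 *m E *m T *m A = col_mx u (P3 *m (B - c *m u)).
  rewrite -!mulmxA eTA mul_block_col mul_block_col.
  by rewrite !mul1mx !mul0mx !addr0 add0r mulNmx addrC.
rewrite (mul_row_col y z u _ : _ = _ :> 'rV_n.+1).
have ed : row_mx y z *m diag_mx (row_mx (u 0 j0)%:M d : 'rV_(1 + m)) =
    row_mx (u 0 j0 *: y) (z *m diag_mx d).
  rewrite diag_mx_row (_ : diag_mx (u 0 j0)%:M = (u 0 j0)%:M); last first.
    by apply/matrixP => i j; rewrite !ord1 !mxE !eqxx.
  by rewrite mul_row_block !mulmx0 addr0 add0r mul_mx_scalar.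
rewrite ed; have row0 : 0 = row_mx 0 0 :> 'rV[V]_(1 + m) by rewrite row_mx0.
rewrite [X in _ <-> _ = X]row0.
have yu_of : u 0 j0 *: y = 0 -> y *m u = 0.
  move=> hy; apply/rowP => j; rewrite [y]mx11_scalar mul_scalar_mx !mxE uE.
  have [r ->] := hmin i0 j; have := congr1 (fun M : 'M_1 => M 0 0) hy.
  by rewrite !mxE uE => e; rewrite mulrCA (mulrC (y 0 0)) e mulr0.
split=> [h|h]; last first.
  have [hy hz] := @eq_row_mx _ 1 1 m _ _ _ _ h.
  by rewrite yu_of // add0r; apply/hP.
(* Column [j0] of the lower block has been cleared, so this coordinate isolates [y]. *)
have hy : u 0 j0 *: y = 0.
  have := congr1 (fun M : 'rV_n.+1 => M 0 j0) h.
  rewrite mulmxA !mxE big_ord1 [X in _ + X]big1 => [|k _].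
    by rewrite addr0 => h0; apply/matrixP => i j; rewrite !ord1 !mxE mulrC.
  by rewrite !mxE big_ord1 hc subrr mulr0.
rewrite yu_of // add0r in h; rewrite hy.
by move/hP: h => ->.
Qed.

Lemma diag_mx_ker m (d : 'rV[V]_m) (x : 'rV[V]_m) :
  x *m diag_mx d = 0 <-> forall i, x 0 i * d 0 i = 0.
Proof.
split=> [h i|h]; last by apply/rowP => i; rewrite mul_mx_diag !mxE.
by have := congr1 (fun y : 'rV_m => y 0 i) h; rewrite mul_mx_diag !mxE.
Qed.

Lemma rowspan_diag m (d : 'rV[V]_m) (x : 'rV[V]_m) :
  rowspan (diag_mx d) x <-> forall i, multiple (d 0 i) (x 0 i).
Proof.
split=> [[w <-] i|/choice[w hw]]; first by rewrite mul_mx_diag mxE; exists (w 0 i).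
by exists (\row_i w i); apply/rowP => i; rewrite mul_mx_diag !mxE hw.
Qed.

(** After a change of basis the kernel of [A] is a product of annihilators of the [d 0 i]. They are
    finitely generated, hence principal, and so are the annihilators of their generators; this
    presents the kernel, and the relations are carried back to [B]. *)
Lemma valuation_exact p q r (A : 'M[V]_(q, p)) (B : 'M[V]_(r, q)) :
  exact_at A B -> exists s (C : 'M[V]_(s, r)), exact_at B C.
Proof.
move=> exAB; have [P [P' [d [PP' P'P hP]]]] := row_diagonalize A.
have kerA (x : 'rV_q) : x *m A = 0 <-> x *m P' *m diag_mx d = 0.
  by rewrite -(propext (hP _)) !mulmxA -(mulmxA x) P'P mulmx1.
pose BP := B *m P'.
have ann i y : y * d 0 i = 0 <-> exists z : 'rV_r, y = (z *m BP) 0 i.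
  split=> [yd|[z ->]].
    have : y *: (delta_mx 0 i : 'rV_q) *m P *m A = 0.
      apply/kerA; rewrite -[_ *m P *m P']mulmxA PP' mulmx1; apply/diag_mx_ker => j.
      by rewrite !mxE /=; case: eqP => [->|]; rewrite ?mulr1 // mulr0 mul0r.
    case/exAB => z ez; exists z.
    by rewrite mulmxA ez -mulmxA PP' mulmx1 !mxE !eqxx mulr1.
  have /kerA/diag_mx_ker : z *m B *m A = 0 by apply/exAB; exists z.
  by rewrite -mulmxA.
clearbody BP.
have /choice[c hc] : forall i, exists c, forall y, y * d 0 i = 0 <-> multiple c y.
  (* A generator is an entry of column [i] dividing the others; without rows the annihilator is
     zero. *)
  move=> i; case: r => [|r] in B exAB BP ann *.
    exists 0 => y; rewrite (propext (ann _ _)); split=> [[z ->]|[k ->]]; last first.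
      by exists 0; rewrite mul0mx mxE mulr0.
    by exists 0; rewrite [z]thinmx0 mul0mx mxE mulr0.
  have [|j _ hj] := @least_multiple _ (fun j => BP j i) (enum 'I_r.+1).
    by rewrite -size_eq0 -cardE card_ord.
  exists (BP j i) => y; rewrite (propext (ann _ _)); split=> [[z ->]|[k ->]].
    rewrite mxE; apply: ideal_sum => [|l _]; first exact: multiple_ideal.
    by apply: idealMl; [apply: multiple_ideal|apply: hj; rewrite mem_enum].
  by exists (k *: delta_mx 0 j); rewrite -scalemxAl -rowE !mxE.
have /choice[g hg] : forall i, exists g, forall x, x * c i = 0 <-> multiple g x.
  by move=> i; apply: annihilator_annihilator (hc i).
pose c' := \row_i c i; pose g' := \row_i g i.
have c'E i : c' 0 i = c i by rewrite mxE.
have g'E i : g' 0 i = g i by rewrite mxE.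
apply: (@exact_change _ _ _ _ _ B (diag_mx c' *m P) (diag_mx g')).
  move=> x; rewrite -(propext (exAB x)) (propext (kerA x)) (propext (diag_mx_ker _ _)).
  transitivity (rowspan (diag_mx c') (x *m P')).
    rewrite (propext (rowspan_diag _ _)).
    by split=> h i; move: (h i); rewrite c'E (propext (hc _ _)).
  split=> [[w ew]|[w <-]]; exists w; first by rewrite mulmxA ew -mulmxA P'P mulmx1.
  by rewrite -!mulmxA PP' mulmx1.
move=> x; rewrite (propext (rowspan_diag _ _)).
transitivity (x *m diag_mx c' = 0).
  split=> [h|h]; last by rewrite mulmxA h mul0mx.
  by rewrite -[LHS]mulmx1 -PP' -[LHS]mulmxA (mulmxA _ P) !mulmxA -(mulmxA x) h mul0mx.
rewrite (propext (diag_mx_ker _ _)).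
by split=> h i; move: (h i); rewrite c'E g'E (propext (hg _ _)).
Qed.

End Valuation.

(** * Localization *)

Section Localization.
Variables (R : comPzRingType) (S : R -> Prop).
Hypotheses (S1 : S 1) (SM : forall s t, S s -> S t -> S (s * t)).

(** Membership is made Boolean so that the subtype inherits the choice structure needed for the
    quotient. *)
Definition denominator := {s : R | `[< S s >]}.

Definition denominator1 : denominator := exist _ 1 (asboolT S1).

Definition denominator_mul (s t : denominator) : denominator :=
  exist _ (sval s * sval t) (asboolT (SM (asboolW (svalP s)) (asboolW (svalP t)))).

Local Notation pair := (R * denominator)%type.

(** The factor [t] keeps the relation transitive when [S] contains zero divisors. *)
Definition loc_equiv (x y : pair) : bool :=
  `[< exists2 t, S t & t * (x.1 * sval y.2) = t * (y.1 * sval x.2) >].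

Lemma loc_equiv_refl : reflexive loc_equiv.
Proof. by move=> x; apply/asboolP; exists 1. Qed.

Lemma loc_equiv_sym : symmetric loc_equiv.
Proof. by move=> x y; apply/asboolP/asboolP => -[t St e]; exists t. Qed.

Lemma loc_equiv_trans : transitive loc_equiv.
Proof.
move=> y x z /asboolP[t St e] /asboolP[u Su f]; apply/asboolP.
exists (t * u * sval y.2); first by apply: SM; [apply: SM|apply: asboolW (svalP y.2)].
transitivity (u * sval z.2 * (t * (x.1 * sval y.2))); first by ring.
rewrite e; transitivity (t * sval x.2 * (u * (y.1 * sval z.2))); first by ring.
by rewrite f; ring.
Qed.

Canonical loc_equivalence := EquivRel loc_equiv loc_equiv_refl loc_equiv_sym loc_equiv_trans.

Definition localization := {eq_quot loc_equiv}%qT.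

HB.instance Definition _ : EqQuotient _ loc_equiv localization := EqQuotient.on localization.
HB.instance Definition _ := Choice.on localization.

Definition loc_pi (x : pair) : localization := (\pi_localization x)%qT.

Lemma loc_piP x y : loc_pi x = loc_pi y <->
  exists2 t, S t & t * (x.1 * sval y.2) = t * (y.1 * sval x.2).
Proof.
split=> [/eqP|h]; first by rewrite /loc_pi eqmodE => /asboolP.
by apply/eqP; rewrite /loc_pi eqmodE; apply/asboolP.
Qed.

Lemma loc_pi_repr x : exists2 t, S t
  & t * (x.1 * sval (repr (loc_pi x)).2) = t * ((repr (loc_pi x)).1 * sval x.2).
Proof. by apply/loc_piP; rewrite /loc_pi reprK. Qed.

Lemma loc_ind (A : localization -> Prop) : (forall x, A (loc_pi x)) -> forall a, A a.
Proof. by move=> hA a; rewrite -[a]reprK; apply: hA. Qed.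

Definition pair_add (x y : pair) : pair :=
  (x.1 * sval y.2 + y.1 * sval x.2, denominator_mul x.2 y.2).
Definition pair_mul (x y : pair) : pair := (x.1 * y.1, denominator_mul x.2 y.2).
Definition pair_opp (x : pair) : pair := (- x.1, x.2).

Definition loc_add (a b : localization) := loc_pi (pair_add (repr a) (repr b)).
Definition loc_mul (a b : localization) := loc_pi (pair_mul (repr a) (repr b)).
Definition loc_opp (a : localization) := loc_pi (pair_opp (repr a)).
Definition to_loc (r : R) : localization := loc_pi (r, denominator1).

Lemma loc_addE x y : loc_add (loc_pi x) (loc_pi y) = loc_pi (pair_add x y).
Proof.
have [t St e] := loc_pi_repr x; have [u Su f] := loc_pi_repr y.
apply/loc_piP; exists (t * u); first exact: SM.
move: (repr (loc_pi x)) (repr (loc_pi y)) e f => x' y' e f /=.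
transitivity (u * (sval y.2 * sval y'.2) * (t * (x'.1 * sval x.2))
  + t * (sval x.2 * sval x'.2) * (u * (y'.1 * sval y.2))); first by ring.
by rewrite -e -f; ring.
Qed.

Lemma loc_mulE x y : loc_mul (loc_pi x) (loc_pi y) = loc_pi (pair_mul x y).
Proof.
have [t St e] := loc_pi_repr x; have [u Su f] := loc_pi_repr y.
apply/loc_piP; exists (t * u); first exact: SM.
move: (repr (loc_pi x)) (repr (loc_pi y)) e f => x' y' e f /=.
transitivity ((t * (x'.1 * sval x.2)) * (u * (y'.1 * sval y.2))); first by ring.
by rewrite -e -f; ring.
Qed.

Lemma loc_oppE x : loc_opp (loc_pi x) = loc_pi (pair_opp x).
Proof.
have [t St e] := loc_pi_repr x; apply/loc_piP; exists t => //.
move: (repr _) e => x' e /=; transitivity (- (t * (x'.1 * sval x.2))); first by ring.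
by rewrite -e; ring.
Qed.

Lemma loc_pi_eq x y : x.1 * sval y.2 = y.1 * sval x.2 -> loc_pi x = loc_pi y.
Proof. by move=> e; apply/loc_piP; exists 1; rewrite // e. Qed.

Lemma loc_addA : associative loc_add.
Proof.
elim/loc_ind=> x; elim/loc_ind=> y; elim/loc_ind=> z.
by rewrite !loc_addE; apply: loc_pi_eq => /=; ring.
Qed.

Lemma loc_addC : commutative loc_add.
Proof.
elim/loc_ind=> x; elim/loc_ind=> y.
by rewrite !loc_addE; apply: loc_pi_eq => /=; ring.
Qed.

Lemma loc_add0 : left_id (to_loc 0) loc_add.
Proof. by elim/loc_ind=> x; rewrite loc_addE; apply: loc_pi_eq => /=; ring. Qed.

Lemma loc_addN : left_inverse (to_loc 0) loc_opp loc_add.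
Proof. by elim/loc_ind=> x; rewrite loc_oppE loc_addE; apply: loc_pi_eq => /=; ring. Qed.

HB.instance Definition _ :=
  GRing.isZmodule.Build localization loc_addA loc_addC loc_add0 loc_addN.

Lemma loc_mulA : associative loc_mul.
Proof.
elim/loc_ind=> x; elim/loc_ind=> y; elim/loc_ind=> z.
by rewrite !loc_mulE; apply: loc_pi_eq => /=; ring.
Qed.

Lemma loc_mulC : commutative loc_mul.
Proof.
elim/loc_ind=> x; elim/loc_ind=> y.
by rewrite !loc_mulE; apply: loc_pi_eq => /=; ring.
Qed.

Lemma loc_mul1 : left_id (to_loc 1) loc_mul.
Proof. by elim/loc_ind=> x; rewrite loc_mulE; apply: loc_pi_eq => /=; ring. Qed.

Lemma loc_mulDl : left_distributive loc_mul loc_add.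
Proof.
elim/loc_ind=> x; elim/loc_ind=> y; elim/loc_ind=> z.
by rewrite !(loc_addE, loc_mulE); apply: loc_pi_eq => /=; ring.
Qed.

HB.instance Definition _ := GRing.Zmodule_isComPzRing.Build localization
  loc_mulA loc_mulC loc_mul1 loc_mulDl.

Lemma to_loc_is_zmod_morphism : zmod_morphism to_loc.
Proof.
move=> x y; rewrite -[LHS]/(loc_pi _) -[RHS]/(loc_add _ (loc_opp _)).
by rewrite loc_oppE loc_addE; apply: loc_pi_eq => /=; ring.
Qed.

Lemma to_loc_is_monoid_morphism : monoid_morphism to_loc.
Proof.
split=> // x y; rewrite -[RHS]/(loc_mul _ _) loc_mulE.
by apply: loc_pi_eq => /=; ring.
Qed.

HB.instance Definition _ := GRing.isZmodMorphism.Build R localization to_loc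
  to_loc_is_zmod_morphism.
HB.instance Definition _ := GRing.isMonoidMorphism.Build R localization to_loc
  to_loc_is_monoid_morphism.

Lemma to_loc_is_localization : is_localization (to_loc : {rmorphism R -> localization}) S.
Proof.
split=> [s Ss|]; last split.
- exists (loc_pi (1, exist _ s (asboolT Ss))); rewrite -[LHS]/(loc_mul _ _) loc_mulE.
  by apply: loc_pi_eq => /=; ring.
- elim/loc_ind=> x; exists x.1, (sval x.2); split; first exact: asboolW (svalP x.2).
  by rewrite -[LHS]/(loc_mul _ _) loc_mulE; apply: loc_pi_eq => /=; ring.
move=> r /loc_piP[t St /= e]; exists t; split=> //.
by move: e; rewrite mulr1 mul0r mulr0.
Qed.

End Localization.

Lemma localization_exists (R : comPzRingType) (S : R -> Prop) :
  S 1 -> (forall s t, S s -> S t -> S (s * t)) ->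
  exists (L : comPzRingType) (phi : {rmorphism R -> L}), is_localization phi S.
Proof.
by move=> S1 SM; exists (localization S1 SM), (@to_loc R S S1 SM);
  apply: to_loc_is_localization.
Qed.

(** * Clearing denominators: matrices, exactness and kernels along a localization *)

Section LocalizationTransfer.
Variables (R L : comPzRingType) (phi : {rmorphism R -> L}) (S : R -> Prop).
Hypotheses (S1 : S 1) (SM : forall s t, S s -> S t -> S (s * t)).
Hypothesis locS : is_localization phi S.

Lemma loc_unit s : S s -> exists u, u * phi s = 1.
Proof. by case: locS => + _ => /[apply] -[u e]; exists u; rewrite mulrC. Qed.

Lemma loc_scale_inj s m n (X Y : 'M[L]_(m, n)) : S s -> phi s *: X = phi s *: Y -> X = Y.
Proof.
move=> /loc_unit[u e] /(congr1 (fun Z => u *: Z)).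
by rewrite !scalerA e !scale1r.
Qed.

Lemma loc_prod (I : Type) (r : seq I) (F : I -> R) :
  (forall i, S (F i)) -> S (\prod_(i <- r) F i).
Proof. by move=> hF; apply: big_ind. Qed.

Lemma loc_mx m n (Y : 'M[L]_(m, n)) :
  exists X s, S s /\ phi s *: Y = map_mx phi X.
Proof.
have [_ [frac _]] := locS.
have /choice[f hf] : forall ij : 'I_m * 'I_n,
    exists rs, S rs.2 /\ Y ij.1 ij.2 * phi rs.2 = phi rs.1.
  by move=> [i j]; have [r [s [Ss e]]] := frac (Y i j); exists (r, s).
exists (\matrix_(i, j) ((\prod_(k | k != (i, j)) (f k).2) * (f (i, j)).1)), (\prod_k (f k).2).
split; first by apply: loc_prod => k; case: (hf k).
apply/matrixP => i j; rewrite !mxE (bigD1 (i, j)) //= !rmorphM /=.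
by have [_ <-] := hf (i, j); rewrite /=; ring.
Qed.

Lemma loc_mx0 m n (X : 'M[R]_(m, n)) : map_mx phi X = 0 -> exists2 s, S s & s *: X = 0.
Proof.
have [_ [_ ker]] := locS => eX.
have /choice[f hf] : forall ij : 'I_m * 'I_n, exists s, S s /\ s * X ij.1 ij.2 = 0.
  by move=> [i j]; apply: ker; move/matrixP/(_ i j): eX; rewrite !mxE.
exists (\prod_k f k); first by apply: loc_prod => k; case: (hf k).
apply/matrixP => i j; rewrite !mxE (bigD1 (i, j)) //= mulrAC.
by have [_ ->] := hf (i, j); rewrite mul0r.
Qed.

(** Flatness of localization, for maps between free modules. *)
Lemma loc_exact p q r (A : 'M[R]_(q, p)) (B : 'M[R]_(r, q)) :
  exact_at A B -> exact_at (map_mx phi A) (map_mx phi B).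
Proof.
move=> exAB z; split=> [zA|[w <-]]; last first.
  rewrite -mulmxA -map_mxM (_ : B *m A = 0) ?map_mx0 ?mulmx0 //.
  by apply/row_matrixP => i; rewrite row_mul row0; apply/exAB/rowspan_row.
have [x [s [Ss e]]] := loc_mx z.
have [|t St] := @loc_mx0 _ _ (x *m A).
  by rewrite map_mxM -e -scalemxAl zA scaler0.
rewrite scalemxAl => /exAB[w ew].
have [u eu] := loc_unit (SM St Ss).
exists (u *: map_mx phi w); rewrite -scalemxAl -map_mxM ew map_mxZ -e !scalerA.
by rewrite -mulrA -rmorphM eu scale1r.
Qed.

(** The rows of [G], cleared of denominators and multiplied by [t] so that they annihilate [B]
    already over [R], generate the kernel up to factors in [S]. *)
Lemma loc_kernel_fg n q m (B : 'M[R]_(n, q)) (G : 'M[L]_(m, n)) :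
  exact_at (map_mx phi B) G ->
  exists k (W : 'M[R]_(k, n)), (forall z, rowspan W z -> z *m B = 0) /\
    forall z, z *m B = 0 -> exists2 s, S s & rowspan W (s *: z).
Proof.
move=> exG; have [X [s [Ss eX]]] := loc_mx G.
have GB : G *m map_mx phi B = 0.
  by apply/row_matrixP => i; rewrite row_mul row0; apply/exG/rowspan_row.
have [|t St tXB] := @loc_mx0 _ _ (X *m B).
  by rewrite map_mxM -eX -scalemxAl GB scaler0.
exists m, (t *: X); split=> [z [w <-]|z zB].
  by rewrite -mulmxA -scalemxAl tXB mulmx0.
have /exG[w ew] : map_mx phi z *m map_mx phi B = 0 by rewrite -map_mxM zB map_mx0.
have [w' [u [Su ew']]] := loc_mx w.
have [|v Sv ev] := @loc_mx0 _ _ ((t * s * u) *: z - w' *m (t *: X)).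
  rewrite map_mxB map_mxZ map_mxM map_mxZ -ew' -eX -ew !rmorphM.
  rewrite -scalemxAl -!scalemxAr !scalerA; apply/eqP; rewrite subr_eq0; apply/eqP.
  by congr (_ *: _); ring.
exists (v * (t * s * u)); first by do ?apply: SM.
exists (v *: w'); rewrite -scalemxAl -scalerA; apply/eqP; rewrite eq_sym -subr_eq0.
by rewrite -scalerBr ev.
Qed.

End LocalizationTransfer.

Lemma maximal_compl1 (R : comPzRingType) (M : R -> Prop) : maximal_ideal M -> ~ M 1.
Proof. by case=> _ []. Qed.

Lemma loc_valuation (R L : comPzRingType) (phi : {rmorphism R -> L}) (M : R -> Prop) :
  ideals_comparable R -> maximal_ideal M -> is_localization phi (fun s => ~ M s) ->
  forall x y : L, multiple y x \/ multiple x y.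
Proof.
move=> cmpR maxM locM x y; have [_ [frac _]] := locM.
have [r [s [Ss ex]]] := frac x; have [r' [s' [Ss' ey]]] := frac y.
have key a c u v t t' (w w' : L) : ~ M a -> ~ M t -> w * phi t = phi u -> w' * phi t' = phi v ->
    a * u = c * v -> multiple w' w.
  move=> Ma Mt ew ew' e; have [b eb] := loc_unit locM (maximal_mul maxM Ma Mt).
  exists (b * phi c * phi t'); have := congr1 phi e; rewrite !rmorphM -ew -ew' => e'.
  rewrite -[LHS]mul1r -eb rmorphM.
  transitivity (b * (phi a * (w * phi t))); first by ring.
  by rewrite e'; ring.
have [a [c [Ma [e|e]]]] := comparable_at cmpR r r' maxM.
  by left; apply: key Ma Ss ex ey e.
by right; apply: key Ma Ss' ey ex e.
Qed.

(** * Presentations and coherence *)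

Section ComparableHomology.
Variable R : comPzRingType.
Hypothesis cmpR : ideals_comparable R.

Lemma kernel_fg_of_local n q (B : 'M[R]_(n, q)) :
  (forall (M : R -> Prop) (L : comPzRingType) (phi : {rmorphism R -> L}),
    maximal_ideal M -> is_localization phi (fun s => ~ M s) ->
    exists m (G : 'M[L]_(m, n)), exact_at (map_mx phi B) G) ->
  exists m (G : 'M[R]_(m, n)), exact_at B G.
Proof.
move=> loc; apply: (local_global_fg cmpR (K := fun x => x *m B = 0)).
  split; first exact: mul0mx.
  split=> [x y hx hy|r x hx]; first by rewrite mulmxDl hx hy addr0.
  by rewrite -scalemxAl hx scaler0.
move=> M maxM; have S1 := maximal_compl1 maxM.
have SM := fun s t => @maximal_mul R M s t maxM.
have [L [phi locM]] := localization_exists S1 SM.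
have [m [G exG]] := loc M L phi maxM locM.
exact: loc_kernel_fg exG.
Qed.

Lemma comparable_exact p q r (A : 'M[R]_(q, p)) (B : 'M[R]_(r, q)) :
  exact_at A B -> exists s (C : 'M[R]_(s, r)), exact_at B C.
Proof.
move=> exAB; apply: kernel_fg_of_local => M L phi maxM locM.
have exL := loc_exact (maximal_compl1 maxM)
  (fun s t => @maximal_mul R M s t maxM) locM exAB.
exact: valuation_exact (loc_valuation cmpR maxM locM) _ _ _ _ _ exL.
Qed.

(** Matrix sizes vary along a resolution, so two consecutive maps are bundled with their sizes to
    make the extension step iterable. *)
Record exact_pair := ExactPair {
  ep_p : nat; ep_q : nat; ep_r : nat;
  ep_A : 'M[R]_(ep_q, ep_p);
  ep_B : 'M[R]_(ep_r, ep_q);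
  ep_exact : exact_at ep_A ep_B }.

Lemma comparable_lambda_dim : lambda_dim_le R 2.
Proof.
exists 2; split=> // E [k [eps [d [epsE [ker_eps ker_d]]]]] m.
have e0 : exact_at (d 0%N) (d 1%N) by move=> x; apply: ker_d.
have step (s : exact_pair) : {t : nat & {C : 'M[R]_(t, ep_r s) | exact_at (ep_B s) C}}.
  have [t ht] := cid (comparable_exact (@ep_exact s)).
  by exists t; apply: cid.
pose next s := ExactPair (svalP (projT2 (step s))).
pose st i := iter i next (ExactPair e0).
(* By computation [ep_B (st i)] is [ep_A (st i.+1)], so [st i] carries exactness at the free module
   of index [i.+1]. *)
exists (fun i => ep_p (st i)), eps, (fun i => ep_A (st i)); split=> //.
split=> [_ x|i _ x]; first exact: ker_eps.
exact: (@ep_exact (st i) x).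
Qed.

End ComparableHomology.

(** * Coherence in terms of relations between the entries of a column *)

Section Coherence.
Variable R : comPzRingType.

(** The codomain [R^o] makes this a linear form whose image is the ideal generated by the entries of
    [v]. *)
Definition dotmx n (v : 'cV[R]_n) (x : 'rV[R]_n) : R^o := (x *m v) 0 0.

Lemma dotmx_is_linear n (v : 'cV[R]_n) : linear (dotmx v).
Proof. by move=> a x y; rewrite /dotmx mulmxDl -scalemxAl !mxE. Qed.

HB.instance Definition _ n (v : 'cV[R]_n) :=
  GRing.isLinear.Build R 'rV[R]_n R^o *:%R (dotmx v) (dotmx_is_linear v).

Lemma dotmxE n (v : 'cV[R]_n) x : x *m v = (dotmx v x)%:M.
Proof. by rewrite [LHS]mx11_scalar. Qed.

Lemma dotmx_eq0 n (v : 'cV[R]_n) x : x *m v = 0 <-> dotmx v x = 0.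
Proof.
split=> [e|e]; first by rewrite /dotmx e mxE.
by apply/matrixP => i j; rewrite !ord1 [RHS]mxE.
Qed.

Lemma fg_ideal_dotmx (I : R -> Prop) :
  fg_ideal I <-> exists n (v : 'cV[R]_n), forall x, I x <-> exists w, dotmx v w = x.
Proof.
split=> [[s hs]|[n [v hv]]].
  exists (size s), (\col_i s`_i) => x; rewrite (propext (hs x)).
  split=> [[c ->]|[w <-]].
    by exists (\row_i c i); rewrite /dotmx mxE; apply: eq_bigr => i _; rewrite !mxE.
  by exists (w 0); rewrite /dotmx mxE; apply: eq_bigr => i _; rewrite !mxE.
pose s := [seq v i 0 | i <- enum 'I_n].
have es : size s = n by rewrite size_map size_enum_ord.
have vs (i : 'I_n) : v i 0 = s`_i.
  by rewrite (nth_map i) ?size_enum_ord // nth_ord_enum.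
exists s => x; rewrite (propext (hv x)); move: s es vs {hv} => s es; subst n => vs.
split=> [[w <-]|[c ->]].
  by exists (w 0); rewrite /dotmx mxE; apply: eq_bigr => i _; rewrite vs.
by exists (\row_i c i); rewrite /dotmx mxE; apply: eq_bigr => i _; rewrite !mxE vs.
Qed.

Lemma dotmx_ideal n (v : 'cV[R]_n) : is_ideal (fun x => exists w, dotmx v w = x).
Proof.
split; first by exists 0; rewrite linear0.
split=> [_ _ [w <-] [w' <-]|r _ [w <-]]; first by exists (w + w'); rewrite linearD.
by exists (r *: w); rewrite linearZ.
Qed.

(** A presentation provided by coherence has its own generators [v']; [exact_change] moves the
    relations to the given [v]. *)
Lemma coherentP : coherent R <->
  forall n (v : 'cV[R]_n), exists m (G : 'M[R]_(m, n)), exact_at v G.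
Proof.
split=> [cohR n v|hR I _ /fg_ideal_dotmx[n [v hv]]].
  have [|k [eps [d [im_eps [ker_eps _]]]]] := cohR _ (dotmx_ideal v).
    by apply/fg_ideal_dotmx; exists n, v.
  pose v' : 'cV[R]_(k 0%N) := \col_i eps (delta_mx 0 i).
  have epsE x : dotmx v' x = eps x.
    rewrite [in RHS](row_sum_delta x) linear_sum /dotmx mxE.
    by apply: eq_bigr => i _; rewrite linearZ mxE.
  have span_dot p (u : 'cV[R]_p) x : rowspan u x <-> exists w, dotmx u w = x 0 0.
    split=> [[w <-]|[w e]]; first by exists w.
    by exists w; rewrite dotmxE e -mx11_scalar.
  apply: (@exact_change _ _ _ _ _ v v' (d 0%N)).
    move=> x; rewrite !(propext (span_dot _ _ _)) (propext (im_eps _)).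
    by split=> -[w e]; exists w; rewrite -e epsE.
  by move=> x; rewrite /rowspan -(propext (ker_eps isT x)) (propext (dotmx_eq0 _ _)) epsE.
have [m [G exG]] := hR n v.
pose k i := if i is 0%N then n else m.
(* The sequence is continued past [G] by zero maps, since exactness is asked only at [R^n]. *)
pose d i : 'M[R]_(k i.+1, k i) :=
  match i return 'M_(m, k i) with 0%N => G | _.+1 => 0 end.
exists k, (dotmx v), d; split=> [y|]; first exact: hv.
split=> // _ x; exact: (iff_trans (iff_sym (dotmx_eq0 v x)) (exG x)).
Qed.

End Coherence.

Theorem theorem2p17 (R : comPzRingType) :
  CF_ring R ->
  lambda_dim_le R 2 /\
  (coherent R <->
   forall M : R -> Prop, maximal_ideal M ->
     forall (L : comPzRingType) (phi : {rmorphism R -> L}),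
       is_localization phi (fun s => ~ M s) -> coherent L).
Proof.
move=> /CF_ideals_comparable cmpR; split; first exact: comparable_lambda_dim.
split=> [/coherentP cohR M maxM L phi locM|cohL].
  have S1 := maximal_compl1 maxM; have SM := fun s t => @maximal_mul R M s t maxM.
  (* Up to the unit [phi s], a column over [L] comes from [R], and scaling by a unit preserves its
     kernel. *)
  apply/coherentP => n v; have [X [s [Ss e]]] := loc_mx S1 SM locM v.
  have [m [G /(loc_exact S1 SM locM) exG]] := cohR n X.
  exists m, (map_mx phi G) => x; rewrite -(propext (exG x)) -e -scalemxAr.
  split=> [->|h]; first by rewrite scaler0.
  by apply: (loc_scale_inj locM Ss); rewrite h scaler0.
apply/coherentP => n v; apply: kernel_fg_of_local => // M L phi maxM locM.
by have /coherentP := cohL M maxM L phi locM; apply.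
Qed.
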